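(* Let $n\ge 1$. The Hrushovski limit $M_n^0$ is a building of type $A_{\infty,n+1}$ all of whose residues have cardinality $\aleph_0$. That is, the set $\Delta$ of maximal flags of $M_n^0$, with the function $\delta:\Delta^2\to W$ described in the context (which is in particular well-defined), is a building of type $A_{\infty,n+1}$, and for every $s\in\{t_0,\dots,t_n\}$ every equivalence class of $\sim_s$ has cardinality $\aleph_0$.
   Context: Graphs. An $L_n$-graph is an (undirected) graph with edge relation $E$ whose vertex set is partitioned into $V_0,\dots,V_n$ (vertices in $V_i$ are ''of type $V_i$''), such that every edge joins a vertex of type $V_{i-1}$ to a vertex of type $V_i$ for some $1\le i\le n$. A path is a sequence of vertices in which consecutive vertices are joined by an edge; its length is its number of edges. A simple cycle $(a,b,\dots,b',a)$ is a closed path with no repeated vertices except the coinciding endpoints (and $b\neq b'$). An $E_i$-cycle is a simple cycle in $V_{i-1}\cup V_i$. An $L_n$-graph is $E_i$-connected if the induced graph on its vertices of types $V_{i-1}$ and $V_i$ is connected (the empty graph counts as connected). Incidence. For $i\le j$, a vertex $x_i$ of type $V_i$ and a vertex $x_j$ of type $V_j$ are incident if there is a sequence $(x_i,x_{i+1},\dots,x_j)$ with $x_l$ of type $V_l$ and $E(x_{l-1},x_l)$ for $l=i+1,\dots,j$ (so a vertex is incident with itself); such a sequence is called a dense flag. A flag is a sequence of distinct pairwise incident vertices; a maximal flag consists of one vertex of each type $V_0,\dots,V_n$. $R(x)$ is the set of vertices incident with $x$. Vertices $x,y$ intersect in the vertex $z$ if the set of type-$V_0$ vertices incident with both $x$ and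 $y$ equals the set of type-$V_0$ vertices incident with $z$; they intersect in the empty set if no type-$V_0$ vertex is incident with both. Dually, with $V_n$ in place of $V_0$, one says that $x,y$ generate the vertex $z$, respectively the empty set. The class $\mathcal K_n$ consists of the finite $L_n$-graphs $A$ such that: (1) $A$ contains no $E_i$-cycles, $i=1,\dots,n$; (2) any $a\ne a'$ in $A$ intersect (in $A$) in a vertex of $A$ or the empty set; (3) any $a\neq a'$ in $A$ generate (in $A$) a vertex of $A$ or the empty set; (4) if $a\in V_i$, $b,b'\in V_{i-1}$ and $\gamma=(a,b,\dots,b',a)$ is a simple cycle of length $k$ contained in $V_h\cup\dots\cup V_i$, $h\le i-2$, then there is a path from $b$ to $b'$ of length at most $k-1$ in $R(a)\cap(V_h\cup\dots\cup V_{i-1})$ all of whose $V_h$-vertices occur in $\gamma$; (5) if $a\in V_i$, $b,b'\in V_{i+1}$ and $\gamma=(a,b,\dots,b',a)$ is a simple cycle of length $k$ contained in $V_i\cup\dots\cup V_h$, $h\ge i+2$, then there is a path from $b$ to $b'$ of length at most $k-1$ in $R(a)\cap(V_{i+1}\cup\dots\cup V_h)$ all of whose $V_h$-vertices occur in $\gamma$. The class $\mathcal K_n'$ consists of those $A\in\mathcal K_n$ which are $E_i$-connected for $i=1,\dots,n$ and in which for every $a\in A$ the residue $R(a)$ is $E_i$-connected for $i=1,\dots,n$. Strong extensions. For a finite $L_n$-graph $A$ which is $E_i$-connected for all $i$ and contains a vertex of each of the types $V_1,\dots,V_{n-1}$ (and is nonempty), the elementary strong extensions of $A$ are: (1) add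 a vertex of type $V_0$ or $V_n$ connected to at most one vertex of $A$ such that the extension is still $E_i$-connected for all $i=1,\dots,n$; (2) if $(x,y,z)$ is a dense flag in $A$, add a vertex $y'$ of the same type as $y$ connected to exactly $x$ and $z$, so that $(x,y',z)$ is a flag. Write $A\le B$ if $B$ arises from $A$ by finitely many elementary strong extensions. $M_n^0$ is the (countable) Hrushovski limit of $(\mathcal K_n',\le)$: $M_n^0=\bigcup_i A_i$ for a chain $A_0\le A_1\le\cdots$ of members of $\mathcal K_n'$, where $A_0$ is a maximal flag, such that whenever $A\in\mathcal K'_n$ is nonempty and contains a flag of type $(V_1,\dots,V_{n-1})$, $A\le A_i$ and $A\le C\in\mathcal K_n'$, there are $j\ge i$ and an embedding $g:C\to A_j$ that is the identity on $A$ with $g(C)\le A_j$. Buildings. Let $W=\langle t_0,\dots,t_n : t_i^2=(t_it_k)^2=1,\ 0\le i,k\le n,\ |k-i|\ge 2\rangle$ and $S=\{t_0,\dots,t_n\}$; its Coxeter diagram is called $A_{\infty,n+1}$. A building of type $A_{\infty,n+1}$ is a set $\Delta$ with a function $\delta:\Delta^2\to W$ such that: (1) for each $s\in S$ the relation $x\sim_s y:\Leftrightarrow\delta(x,y)\in\{1,s\}$ is an equivalence relation on $\Delta$ each of whose classes has at least $2$ elements; (2) whenever $w=r_1\cdots r_k$ is a shortest representation of $w\in W$ with $r_i\in S$ and $x,y\in\Delta$, then $\delta(x,y)=w$ if and only if there is a sequence $x=x_0,x_1,\dots,x_k=y$ in $\Delta$ with $x_{i-1}\ne x_i$ and $\delta(x_{i-1},x_i)=r_i$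 for $i=1,\dots,k$. $M_n^0$ as a building. $\Delta$ is the set of maximal flags of $M_n^0$. Put $\delta(x,x)=1$, put $\delta(x,y)=t_i$ if and only if the maximal flags $x,y$ differ exactly in their vertex of type $V_i$, and for a reduced word $w=r_1\cdots r_k$ put $\delta(x,y)=w$ if and only if there are $x=x_0,x_1,\dots,x_k=y$ in $\Delta$ with $x_{i-1}\neq x_i$ and $\delta(x_{i-1},x_i)=r_i$ for all $i$. *)

(* Defs.v *)
From HB Require Import structures.
From mathcomp Require Import all_boot.
From mathcomp Require Import boolp classical_sets functions cardinality.
From Stdlib Require Relations.

Set Implicit Arguments.
Unset Strict Implicit.
Unset Printing Implicit Defensive.

Local Open Scope classical_set_scope.
Local Open Scope quotient_scope.

Record lgraph (n : nat) := LGraph {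
  vertex :> choiceType;
  vtype : vertex -> 'I_n.+1;
  edge : rel vertex;
  edgeC : symmetric edge;
  edge_vtype : forall x y, edge x y ->
    (vtype x).+1 = vtype y :> nat \/ (vtype y).+1 = vtype x :> nat
}.
Arguments vtype {n l}.
Arguments edge {n l}.

(** A set of vertices [A : set G] stands for the subgraph of [G] it induces;
    [[set: G]] stands for [G] itself. All notions below are those of the induced
    subgraph: every path and every incidence in [A] uses vertices of [A] only. *)
Section Notions.
Variables (n : nat) (G : lgraph n).
Implicit Types (A B : set G) (a b x y z : G) (s p c : seq G).

(** The sequence is [x :: p]; its length is the number [size p] of edges. *)
Definition path_in A x p y : Prop :=
  [/\ path edge x p, last x p = y & [set` x :: p] `<=` A].

Definition connected_in A : Prop :=
  forall x y, A x -> A y -> exists p, path_in A x p y.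

Definition Econnected A (i : nat) : Prop :=
  connected_in
    [set x | A x /\ (vtype x = i.-1 :> nat \/ vtype x = i :> nat)].

(** The cycle [(a, b, ..., b', a)] is the cyclic sequence
    [a :: b :: ... :: b'], so its length is its size; the requirement that [b]
    and [b'] differ amounts to having at least three vertices. *)
Definition simple_cycle A c : Prop :=
  [/\ (2 < size c)%N, ucycle edge c & [set` c] `<=` A].

Definition Ecycle A (i : nat) c : Prop :=
  simple_cycle A c /\
  forall x, x \in c -> vtype x = i.-1 :> nat \/ vtype x = i :> nat.

Definition dense_flag A s : Prop :=
  [/\ [set` s] `<=` A,
      sorted edge s
    & sorted (fun u v => vtype v == (vtype u).+1 :> nat) s].

Definition incident A x y : Prop :=
  exists p, (dense_flag A (x :: p) /\ last x p = y) \/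
            (dense_flag A (y :: p) /\ last y p = x).

Definition flag A s : Prop :=
  [/\ uniq s, [set` s] `<=` A
    & forall x y, x \in s -> y \in s -> incident A x y].

(** [flag_of_type A [:: i_1; ...; i_k] s]: [s] is a flag whose vertices are
    successively of type [i_1, ..., i_k]. *)
Definition flag_of_type A (ts : seq nat) s : Prop :=
  flag A s /\ [seq (vtype x : nat) | x <- s] = ts.

Definition maximal_flag A s : Prop := flag_of_type A (iota 0 n.+1) s.

Definition residue A x : set G := [set y | incident A x y].

(** Vertices of type [m] incident with [x] *)
Definition shadow A (m : nat) x : set G :=
  residue A x `&` [set v | vtype v = m :> nat].

(** For [m = 0] the vertices [x, y] intersect, and for [m = n] they generate,
    the vertex [z], respectively the empty set. *)
Definition meet_in_vertex A m x y z : Prop :=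
  A z /\ shadow A m x `&` shadow A m y = shadow A m z.

Definition meet_in_empty A m x y : Prop :=
  shadow A m x `&` shadow A m y = set0.

Definition meets_closed A m : Prop :=
  forall a a', A a -> A a' -> a <> a' ->
    (exists z, meet_in_vertex A m a a' z) \/ meet_in_empty A m a a'.

Definition cycles_reduce_down A : Prop :=
  forall (a b b' : G) s (h : 'I_n.+1),
    let c := a :: b :: rcons s b' in
    simple_cycle A c ->
    (vtype b).+1 = vtype a :> nat -> (vtype b').+1 = vtype a :> nat ->
    (h.+2 <= vtype a)%N ->
    (forall v, v \in c -> h <= vtype v <= vtype a)%N ->
    exists p,
      [/\ path_in (residue A a `&` [set v | (h <= vtype v < vtype a)%N]) b p b',
          (size p <= (size c).-1)%N
        & forall v, v \in b :: p -> vtype v = h -> v \in c].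

Definition cycles_reduce_up A : Prop :=
  forall (a b b' : G) s (h : 'I_n.+1),
    let c := a :: b :: rcons s b' in
    simple_cycle A c ->
    vtype b = (vtype a).+1 :> nat -> vtype b' = (vtype a).+1 :> nat ->
    ((vtype a).+2 <= h)%N ->
    (forall v, v \in c -> vtype a <= vtype v <= h)%N ->
    exists p,
      [/\ path_in (residue A a `&` [set v | (vtype a < vtype v <= h)%N]) b p b',
          (size p <= (size c).-1)%N
        & forall v, v \in b :: p -> vtype v = h -> v \in c].

Definition classK A : Prop :=
  finite_set A /\
  [/\ forall i c, (1 <= i <= n)%N -> ~ Ecycle A i c,
      meets_closed A 0,
      meets_closed A n,
      cycles_reduce_down A
    & cycles_reduce_up A].

Definition classK' A : Prop :=
  [/\ classK A,
      forall i, (1 <= i <= n)%N -> Econnected A i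
    & forall a i, A a -> (1 <= i <= n)%N -> Econnected (residue A a) i].

Definition extendable A : Prop :=
  [/\ finite_set A, A !=set0,
      forall i, (1 <= i <= n)%N -> Econnected A i
    & forall i, (1 <= i <= n.-1)%N -> exists x, A x /\ vtype x = i :> nat].

Definition end_extension A y : Prop :=
  [/\ vtype y = 0 :> nat \/ vtype y = n :> nat,
      forall u v, A u -> A v -> edge y u -> edge y v -> u = v
    & forall i, (1 <= i <= n)%N -> Econnected (y |` A) i].

Definition middle_extension A y' : Prop :=
  exists x y z,
    [/\ dense_flag A [:: x; y; z], vtype y' = vtype y
      & forall u, A u -> (edge y' u <-> u = x \/ u = z)].

Definition elementary_strong A B : Prop :=
  extendable A /\
  exists y, [/\ ~ A y, B = y |` A & end_extension A y \/ middle_extension A y].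

Definition strong : set G -> set G -> Prop :=
  Relation_Operators.clos_refl_trans _ elementary_strong.

End Notions.

Definition embedding_on (n : nat) (G H : lgraph n) (A : set G) (f : G -> H) :
    Prop :=
  [/\ {in A &, injective f},
      {in A, forall x, vtype (f x) = vtype x}
    & {in A &, forall x y, edge (f x) (f y) = edge x y}].

(** The extension [C] of [A] is an abstract graph [H], with [A] sitting in [H]
    through [f]. *)
Definition hrushovski_limit (n : nat) (M : lgraph n) : Prop :=
  exists A_ : nat -> set M,
    [/\ (forall i, classK' (A_ i)) /\
        exists s, maximal_flag (A_ 0) s /\ A_ 0 = [set` s],
        forall i, strong (A_ i) (A_ i.+1),
        \bigcup_i A_ i = [set: M]
      & forall (i : nat) (A : set M),
        classK' A -> A !=set0 ->
        (exists s, flag_of_type A (iota 1 n.-1) s) ->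
        strong A (A_ i) ->
        forall (H : lgraph n) (f : M -> H),
          embedding_on A f -> classK' [set: H] ->
          strong (f @` A) [set: H] ->
          exists j (g : H -> M),
            [/\ (i <= j)%N, embedding_on [set: H] g,
                {in A, cancel f g} & strong (range g) (A_ j)]].

(** Since the generators are involutions, the presented group is the quotient
    of the monoid of words in the generators by the congruence generated by the
    relations, inversion being the reversal of words. *)
Inductive cox_equiv (n : nat) : seq 'I_n.+1 -> seq 'I_n.+1 -> Prop :=
| cox_refl u : cox_equiv u u
| cox_sym u v : cox_equiv u v -> cox_equiv v u
| cox_trans u v w : cox_equiv u v -> cox_equiv v w -> cox_equiv u w
| cox_cat u u' v v' :
    cox_equiv u u' -> cox_equiv v v' -> cox_equiv (u ++ v) (u' ++ v')
| cox_square i : cox_equiv [:: i; i] [::]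
| cox_commute (i k : 'I_n.+1) :
    (i.+2 <= k)%N || (k.+2 <= i)%N -> cox_equiv [:: i; k; i; k] [::].

Section CoxeterCongruence.
Variable n : nat.
Implicit Types u v w : seq 'I_n.+1.

Definition cox_rel : rel (seq 'I_n.+1) := fun u v => `[< cox_equiv u v >].

Fact cox_rel_refl : reflexive cox_rel.
Proof. by move=> u; apply/asboolP; exact: cox_refl. Qed.

Fact cox_rel_sym : symmetric cox_rel.
Proof. by move=> u v; apply/asboolP/asboolP; exact: cox_sym. Qed.

Fact cox_rel_trans : transitive cox_rel.
Proof.
by move=> v u w /asboolP uv /asboolP vw; apply/asboolP; exact: cox_trans vw.
Qed.

Canonical cox_equiv_rel :=
  EquivRel cox_rel cox_rel_refl cox_rel_sym cox_rel_trans.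

End CoxeterCongruence.

Definition cox (n : nat) : Type := {eq_quot (@cox_rel n)}.
HB.instance Definition _ (n : nat) := Choice.on (cox n).
HB.instance Definition _ (n : nat) := EqQuotient.on (cox n).

Section CoxeterGroup.
Variable n : nat.
Implicit Types u v w : seq 'I_n.+1.
Local Notation cox := (cox n).

Lemma cox_piP u v : (\pi_cox u = \pi_cox v) <-> cox_equiv u v.
Proof.
split=> [/eqP|uv]; first by rewrite eqquotE => /asboolP.
by apply/eqP; rewrite eqquotE; apply/asboolP.
Qed.

Definition cox_one : cox := \pi_cox [::].
Definition cox_mul (g h : cox) : cox := \pi_cox (repr g ++ repr h).
Definition cox_inv (g : cox) : cox := \pi_cox (rev (repr g)).

Lemma cox_repr u : cox_equiv (repr (\pi_cox u)) u.
Proof. by apply/cox_piP; rewrite reprK. Qed.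

Lemma cox_mulE u v : cox_mul (\pi_cox u) (\pi_cox v) = \pi_cox (u ++ v).
Proof. by apply/cox_piP; apply: cox_cat; exact: cox_repr. Qed.

Lemma cox_rev_cat u : cox_equiv (rev u ++ u) [::].
Proof.
elim: u => [|i u IHu]; first exact: cox_refl.
rewrite rev_cons -cats1 -catA; apply: cox_trans IHu.
apply: cox_cat; first exact: cox_refl.
rewrite /= -[X in cox_equiv _ X]cat0s -[i :: i :: u]/([:: i; i] ++ u).
by apply: cox_cat; [exact: cox_square | exact: cox_refl].
Qed.

Fact cox_mulA : associative cox_mul.
Proof.
elim/quotW=> u; elim/quotW=> v; elim/quotW=> w.
by rewrite (cox_mulE v w) (cox_mulE u (v ++ w)) (cox_mulE u v)
           (cox_mulE (u ++ v) w) catA.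
Qed.

Fact cox_mul1g : left_id cox_one cox_mul.
Proof. by elim/quotW=> u; rewrite cox_mulE. Qed.

Fact cox_mulg1 : right_id cox_one cox_mul.
Proof. by elim/quotW=> u; rewrite cox_mulE cats0. Qed.

Fact cox_mulVg : left_inverse cox_one cox_inv cox_mul.
Proof.
move=> g; rewrite -{2}[g]reprK cox_mulE.
by apply/cox_piP; exact: cox_rev_cat.
Qed.

Fact cox_mulgV : right_inverse cox_one cox_inv cox_mul.
Proof.
move=> g; rewrite -{1}[g]reprK cox_mulE.
by apply/cox_piP; rewrite -{1}[repr g]revK; exact: cox_rev_cat.
Qed.

HB.instance Definition _ := isGroup.Build cox
  cox_mulA cox_mul1g cox_mulg1 cox_mulVg cox_mulgV.

Definition cox_gen (i : 'I_n.+1) : cox := \pi_cox [:: i].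

End CoxeterGroup.

Section Buildings.
Variables (I : Type) (W : groupType) (t : I -> W).

(** Words in the generating set [S] are given by the indices of their letters. *)
Definition word_prod (r : seq I) : W := (\big[*%g/1]_(i <- r) t i)%g.

Definition reduced (r : seq I) : Prop :=
  forall r', word_prod r' = word_prod r -> (size r <= size r')%N.

Variables (Delta : Type) (delta : Delta -> Delta -> W).

Definition adjacent (i : I) (x y : Delta) : Prop :=
  delta x y = 1%g \/ delta x y = t i.

Fixpoint gallery (r : seq I) (x y : Delta) : Prop :=
  if r is i :: r' then
    exists z, [/\ x <> z, delta x z = t i & gallery r' z y]
  else x = y.

Definition building : Prop :=
  (forall i, Relation_Definitions.equivalence Delta (adjacent i) /\
     forall x, exists y z, [/\ adjacent i x y, adjacent i x z & y <> z]) /\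
  (forall r, reduced r ->
     forall x y, delta x y = word_prod r <-> gallery r x y).

End Buildings.

Section Chambers.
Variables (n : nat) (M : lgraph n).

Definition chamber : Type :=
  set_type [set x : n.+1.-tuple M | maximal_flag [set: M] x].

Definition chamber_vertex (x : chamber) (i : 'I_n.+1) : M := tnth (val x) i.

Definition differ_exactly (i : 'I_n.+1) (x y : chamber) : Prop :=
  forall j, chamber_vertex x j <> chamber_vertex y j <-> j = i.

Definition flag_distance (delta : chamber -> chamber -> cox n) : Prop :=
  [/\ forall x, delta x x = 1%g,
      forall i x y, delta x y = cox_gen i <-> differ_exactly i x y
    & forall r, reduced (@cox_gen n) r -> forall x y,
        delta x y = word_prod (@cox_gen n) r <->
        gallery (@cox_gen n) delta r x y].

End Chambers.

(* Main.v *)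
(** Along the construction of the limit, every elementary strong extension adds a clone
    y' of a vertex y: y' has the type of y and its neighbours are exactly one vertex of
    each of the two adjacent types, both of them neighbours of y. So every member of the
    chain is obtained from a maximal flag by adding clones, and everything is proved by
    induction on clones, folding y' onto y.

    - Such a graph lies in K'_n: seen as an ordered set (by incidence) any two elements
      with a common lower bound have a greatest one, and a walk avoiding a between two
      elements below a can be replaced by a walk below a that is not longer.

    - The maximal flags of such a graph carry a W-valued distance satisfying the axioms
      of a building except that panels may be small: a flag c through y' is put at the
      longer of the two elements w, w s from d, where w is the distance from d to the flag
      obtained from c by folding and s is the type of y'. Hence the types of two reduced
      galleries with the same ends are equal in W. The folded flag is adjacent to c, so
      any two flags are joined by a gallery.

    The extension property of the limit, applied to one more clone in a given panel, makes
    all panels infinite. In W, descents are handled by the parity of the number of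
    occurrences of a reflection in a word, a cocycle from which the deletion and exchange
    conditions follow; two neighbouring generators are never both descents of the same
    element, because their product has infinite order. *)
Require Import Defs.
From mathcomp Require Import all_boot order ssralg ssrnum ssrint.
From mathcomp Require Import boolp classical_sets functions cardinality.
From mathcomp Require Import zify.

Set Implicit Arguments.
Unset Strict Implicit.
Unset Printing Implicit Defensive.

Lemma exists_shortest (T : Type) (P : seq T -> Prop) (u0 : seq T) :
  P u0 -> exists2 u, P u & forall v, P v -> size u <= size v.
Proof.
move: {2}(size u0) (leqnn (size u0)) => m; elim: m u0 => [|m IHm] u0 le_m Pu0.
  by exists u0 => // v _; apply: leq_trans le_m _.
have [[v Pv lt_v]|no] := pselect (exists2 v, P v & size v < size u0).
  by apply: (IHm v) => //; rewrite -ltnS (leq_trans lt_v).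
by exists u0 => // v Pv; rewrite leqNgt; apply/negP => lt_v; apply: no; exists v.
Qed.

(** * The Coxeter group *)

Section Words.
Variable n : nat.
Local Notation W := (cox n).
Local Notation s := (@cox_gen n).
Local Notation "''w' u" := (word_prod s u) (at level 8, u at level 8).
Implicit Types (i j k : 'I_n.+1) (u v r p q : seq 'I_n.+1) (w t : W).
Local Open Scope group_scope.

Definition far i k := (i.+2 <= k)%N || (k.+2 <= i)%N.

Lemma farC i k : far i k = far k i. Proof. by rewrite /far orbC. Qed.

Lemma far_neq i k : far i k -> i != k.
Proof. by apply: contraTneq => ->; rewrite /far; lia. Qed.

Lemma wnil : 'w [::] = 1. Proof. exact: big_nil. Qed.
Lemma wcons i u : 'w (i :: u) = s i * 'w u. Proof. exact: big_cons. Qed.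
Lemma wcat u v : 'w (u ++ v) = 'w u * 'w v. Proof. exact: big_cat. Qed.
Lemma wseq1 i : 'w [:: i] = s i. Proof. exact: big_seq1. Qed.

Lemma word_prod_pi u : 'w u = \pi_(cox n)%qT u.
Proof.
elim: u => [|i u IHu]; first by rewrite wnil.
by rewrite wcons IHu; exact: (cox_mulE [:: i] u).
Qed.

Lemma word_prod_eqP u v : 'w u = 'w v <-> cox_equiv u v.
Proof. by rewrite !word_prod_pi; exact: cox_piP. Qed.

Lemma word_prod_surj w : exists u, 'w u = w.
Proof. by exists (repr w); rewrite word_prod_pi reprK. Qed.

Lemma gen_sq i : s i * s i = 1.
Proof. by rewrite -[RHS]wnil -!wseq1 -wcat; apply/word_prod_eqP/cox_square. Qed.

Lemma gen_inv i : (s i)^-1 = s i.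
Proof. by apply: (mulgI (s i)); rewrite mulgV gen_sq. Qed.

Lemma gen_mulK i w : s i * (s i * w) = w.
Proof. by rewrite mulgA gen_sq mul1g. Qed.

Lemma far_comm i k : far i k -> s i * s k = s k * s i.
Proof.
move=> ik; have : 'w [:: i; k; i; k] = 1 by
  rewrite -[RHS]wnil; apply/word_prod_eqP/cox_commute.
rewrite !wcons wnil mulg1 => e.
by apply: (mulIg (s i * s k)); rewrite -!mulgA e gen_mulK gen_sq.
Qed.

Lemma word_prod_rev u : 'w (rev u) = ('w u)^-1.
Proof.
elim: u => [|i u IHu]; first by rewrite wnil invg1.
by rewrite rev_cons -cats1 wcat IHu (wseq1 i) wcons invgM gen_inv.
Qed.

(** Universal property of the presentation, for words acting on a set. Elements of the group are
    separated below by two such actions: parity of a letter, and reflections of the integers. *)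
Lemma cox_equiv_hom (T : Type) (f : seq 'I_n.+1 -> T -> T) :
  (forall u v x, f (u ++ v) x = f u (f v x)) -> (forall x, f [::] x = x) ->
  (forall i x, f [:: i; i] x = x) ->
  (forall i k x, far i k -> f [:: i; k; i; k] x = x) ->
  forall u v, 'w u = 'w v -> f u =1 f v.
Proof.
move=> fcat fnil fsq fcomm u v /word_prod_eqP.
elim=> {u v} [u|u v _ IH|u v w _ IH1 _ IH2|u u' v v' _ IHu _ IHv|i|i k ik] x.
- by [].
- by rewrite IH.
- by rewrite IH1 IH2.
- by rewrite !fcat IHv IHu.
- by rewrite fsq fnil.
- by rewrite fcomm // fnil.
Qed.

(** Every relator contains each letter an even number of times. *)
Lemma word_prod_parity i u v :
  'w u = 'w v -> odd (count_mem i u) = odd (count_mem i v).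
Proof.
pose f u (b : bool) := odd (count_mem i u) (+) b.
move=> uv; suff /(_ false) : f u =1 f v by rewrite /f !addbF.
apply: cox_equiv_hom uv => [u' v' b|b|j b|j k b _]; rewrite /f //.
- by rewrite count_cat oddD addbA.
- by rewrite /= addn0 addnn odd_double.
- by rewrite /= addn0; do 2!case: (_ == _).
Qed.

Lemma cox_gen_inj : injective s.
Proof.
move=> i k; rewrite -!wseq1 => /(word_prod_parity i) /=.
by rewrite eqxx; case: eqP.
Qed.

(* crossw u t is the parity of the number of j with t = p s_j p^-1 for u = p j q. *)
Fixpoint crossw u t : bool :=
  if u is i :: u' then (t == s i) (+) crossw u' (t ^ s i) else false.

Lemma crossw_cat u v t : crossw (u ++ v) t = crossw u t (+) crossw v (t ^ 'w u).
Proof.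
elim: u t => [|i u IHu] t /=; first by rewrite wnil conjg1.
by rewrite IHu wcons conjgM addbA.
Qed.

Lemma gen_conj_self i : s i ^ s i = s i.
Proof. by rewrite conjgE mulKg. Qed.

Lemma gen_conj_far i k : far i k -> s i ^ s k = s i.
Proof. by move/far_comm=> c; rewrite conjgE c mulKg. Qed.

(** The relators contribute nothing: [i i] meets the reflection [s i] twice, and for far [i], [k]
    the word [i k i k] meets [s i] and [s k] twice each, since commuting generators conjugate each
    other trivially. *)
Lemma crossw_eq u v t : 'w u = 'w v -> crossw u t = crossw v t.
Proof.
have conj_self (j : 'I_n.+1) t' : (t' ^ s j == s j) = (t' == s j).
  by rewrite -{2}(gen_conj_self j) (inj_eq (conjg_inj _)).
move=> /word_prod_eqP uv; elim: uv t => {u v} [u|u v _ IH|u v w _ IH1 _ IH2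
  |u u' v v' uu' IHu _ IHv|i|i k ik] t //=.
- by rewrite IH1 IH2.
- by rewrite !crossw_cat IHu IHv; move/word_prod_eqP: uu' => ->.
- by rewrite addbF conj_self addbb.
have ki : far k i by rewrite farC.
have conj_eq (j l : 'I_n.+1) t' : far j l -> (t' ^ s j == s l) = (t' == s l).
  by rewrite farC => /gen_conj_far jl; rewrite -{1}jl (inj_eq (conjg_inj _)).
rewrite addbF (conj_eq i k (_ ^ s k)) // conj_self (conj_eq k i) // conj_self.
rewrite (conj_eq i k) //.
by case: (t == s i); case: (t == s k).
Qed.

Definition cross w t := crossw (repr w) t.

Lemma cross_word u t : cross ('w u) t = crossw u t.
Proof. by apply: crossw_eq; rewrite word_prod_pi reprK. Qed.

Lemma cross_mul w w' t : cross (w * w') t = cross w t (+) cross w' (t ^ w).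
Proof.
have [u <-] := word_prod_surj w; have [v <-] := word_prod_surj w'.
by rewrite -wcat !cross_word crossw_cat.
Qed.

Lemma cross1 t : cross 1 t = false. Proof. by rewrite -wnil cross_word. Qed.
Lemma cross_gen i t : cross (s i) t = (t == s i). Proof. by rewrite -(wseq1 i) cross_word /= addbF wseq1. Qed.

Lemma cross_smul i w : cross (s i * w) (s i) = ~~ cross w (s i).
Proof. by rewrite cross_mul cross_gen eqxx gen_conj_self. Qed.

Lemma cross_inv w t : cross w^-1 (t ^ w) = cross w t.
Proof.
have := cross1 t; rewrite -(mulgV w) cross_mul.
by case: (cross w t); case: (cross _ _).
Qed.

(** Deletion: an odd count is positive, so [u = p j q] with [t = p s_j p^-1], and then
    [t u = p q]. *)
Lemma crossw_delete u t : crossw u t ->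
  exists u', [/\ 'w u' = t * 'w u, (size u').+1 = size u & {subset u' <= u}].
Proof.
elim: u t => // i u IHu t /=; have [-> _|_ /= /IHu[u' [e1 e2 sub]]] := eqVneq.
  exists u; split=> //; first by rewrite wcons gen_mulK.
  by move=> j ju; rewrite inE ju orbT.
exists (i :: u'); split=> [|/=|j]; last 2 first.
- by rewrite e2.
- by rewrite !inE => /orP[->//|/sub->]; rewrite orbT.
by rewrite !wcons e1 conjgE !mulgA mulgV mul1g.
Qed.

Lemma cross_mul_far i k w : far i k -> cross (s k * w) (s i) = cross w (s i).
Proof.
by move=> ik; rewrite cross_mul cross_gen (inj_eq cox_gen_inj) (negbTE (far_neq ik)) gen_conj_far.
Qed.

Lemma crossw_far i u : all (far i) u -> crossw u (s i) = false.
Proof.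
elim: u => //= k u IHu /andP[ik /IHu uF].
by rewrite gen_conj_far // uF (inj_eq cox_gen_inj) (negbTE (far_neq ik)).
Qed.

Lemma word_far_comm i u : all (far i) u -> s i * 'w u = 'w u * s i.
Proof.
elim: u => [|k u IHu] /=; first by rewrite wnil mul1g mulg1.
by move=> /andP[ik /IHu e]; rewrite wcons mulgA far_comm // -!mulgA e.
Qed.

(* Exchange: right multiplication by a generator changes the status of the left
   descent i only if it amounts to left multiplication by s_i. *)
Lemma cross_mulr w i k :
  cross (w * s k) (s i) = cross w (s i) (+) (s i * w == w * s k).
Proof.
rewrite cross_mul cross_gen conjgE; congr (_ (+) _).
by rewrite -(inj_eq (mulgI w)) !mulgA mulgV mul1g.
Qed.

(** The usual left descent, that [s i * w] is shorter than [w], stated without a length function;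
    deletion links the two. *)
Definition ldescent w i := cross w (s i).
Definition rdescent w i := cross w^-1 (s i).

(** The hypothesis says that [w] conjugates [s i] to [s k], and inverting [w] keeps the parity up to
    this conjugation. *)
Lemma ldescent_rdescent w i k : s i * w = w * s k -> ldescent w i = rdescent w k.
Proof.
by move=> e; rewrite /rdescent /ldescent -cross_inv conjgE e mulgA mulVg mul1g.
Qed.

(* For adjacent i and k the product s_i s_k has infinite order, as witnessed by
   the reflections x |-> 1 - x and x |-> -1 - x of the integers; reduced words in
   i and k starting with i move 0 to the right, those starting with k to the left. *)
Section InfiniteDihedral.
Variables (i k : 'I_n.+1).
Hypotheses (ik : ~~ far i k) (neq_ik : i != k).
Local Open Scope ring_scope.
Import GRing.Theory.

Definition refl j (x : int) : int :=
  if j == i then 1 - x else if j == k then - 1 - x else x.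

Lemma refl_word u v : 'w u = 'w v -> foldr refl 0 u = foldr refl 0 v.
Proof.
pose f (w : seq 'I_n.+1) x := foldr refl x w.
move=> uv; suff /(_ 0) : f u =1 f v by [].
apply: cox_equiv_hom uv; rewrite /f.
- by move=> u' v' x; rewrite foldr_cat.
- by [].
- by move=> j x /=; rewrite /refl; case: eqP => _; [lia|case: eqP => _; lia].
- move=> j l x jl /=; rewrite /refl.
  (* Two far letters cannot be [i] and [k], so at most one of them moves anything, and it acts
     twice. *)
  have ki : ~~ far k i by rewrite farC.
  have [ej|_] := eqVneq j i; first subst j.
    have -> : (l == i) = false by apply/negP => /eqP e; subst l; move: jl; rewrite /far; lia.
    have -> : (l == k) = false by apply/negP => /eqP e; subst l; move: ik; rewrite jl.
    lia.
  have [ej|_] := eqVneq j k; first subst j.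
    have -> : (l == k) = false by apply/negP => /eqP e; subst l; move: jl; rewrite /far; lia.
    have -> : (l == i) = false by apply/negP => /eqP e; subst l; move: ki; rewrite jl.
    lia.
  by case: eqP => _; [lia|case: eqP => _; lia].
Qed.

Let dih u := all (mem [:: i; k]) u.
Let short u := dih u /\ forall v, dih v -> 'w v = 'w u -> (size u <= size v)%N.

Lemma refl_short j u : short (j :: u) ->
  if j == i then 0 < foldr refl 0 (j :: u) else foldr refl 0 (j :: u) < 0.
Proof.
elim: u j => [|l u IHu] j [/= /andP[jik dlu] smin].
  by rewrite /= /refl; move: jik; rewrite !inE; case: eqP => //= _ ->.
have {}IHu := IHu l.
have sh : short (l :: u).
  split=> // v dv e; rewrite -ltnS.
  by apply: (smin (j :: v)); rewrite /= ?jik ?dv // !wcons e wcons.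
(* A shortest word alternates: two equal letters in front would cancel. *)
have jl : l != j.
  apply/eqP => e; subst l; have := smin u; rewrite !wcons gen_mulK => /(_ _ erefl).
  by move: dlu => /andP[_ ->] /(_ isT); lia.
move/IHu: sh; rewrite [foldr refl 0 (l :: u)]/=; move: (refl l _) => x {IHu smin}.
move: jik dlu; rewrite !inE => jik /andP[lik _].
rewrite /refl; move: jl.
have neq_ki : (k == i) = false by rewrite eq_sym (negbTE neq_ik).
by case/orP: jik lik => /eqP-> /orP[]/eqP->;
  rewrite ?eqxx // ?neq_ki ?(negbTE neq_ik) => _; lia.
Qed.


(** Write [w = u q] with [u] in the subgroup generated by [s i] and [s k], and [q] shortest. By
    deletion no element of the subgroup crosses [q], so [u] has the descents [i] and [k] of [w]. If
    both occurred, [u] would have shortest words starting with [i] and with [k], which move 0 to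
    opposite sides. *)
Lemma adjacent_descents w : ~~ (ldescent w i && ldescent w k).
Proof.
apply/negP; rewrite /ldescent => /andP[wi wk].
have [w0 e0] := word_prod_surj w.
(* a shortest representative q of the coset of w *)
have Pw0 : exists2 u, dih u & ('w u * 'w w0 = w)%g.
  by exists [::]; rewrite // wnil mul1g.
have [q [u du e] qmin] := exists_shortest
  (P := fun q => exists2 u, dih u & ('w u * 'w q = w)%g) Pw0.
have Nq d : dih d -> crossw q ('w d) = false.
  move=> dd; apply/negP => /crossw_delete[q' [e' sz _]].
  suff /qmin : exists2 v, dih v & ('w v * 'w q' = w)%g by rewrite -sz ltnn.
  exists (u ++ rev d); first by rewrite /dih all_cat all_rev [all _ u]du [all _ d]dd.
  by rewrite e' wcat word_prod_rev mulgA mulgVK.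
have Nu j : j \in [:: i; k] -> cross w (s j) = crossw u (s j).
  move=> jik; rewrite -e cross_mul !cross_word.
  rewrite -[s j](wseq1 j) conjgE -word_prod_rev -!wcat Nq ?addbF //.
  by rewrite /dih !all_cat all_rev [all _ u]du /= jik.
have [v [dv ev] vmin] := exists_shortest
  (P := fun v => dih v /\ ('w v = 'w u)%g) (u0 := u) (conj du erefl).
have sh j : j \in [:: i; k] -> cross w (s j) ->
    exists2 v', short (j :: v') & 'w (j :: v') = 'w u.
  move=> jik; rewrite Nu // (crossw_eq _ (esym ev)) => /crossw_delete[v' [e1 sz sub]].
  have ej : 'w (j :: v') = 'w u by rewrite wcons e1 gen_mulK.
  exists v' => //; split=> [|x dx ex].
    by rewrite /dih /= jik; apply/allP => x /sub /(allP dv).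
  by rewrite /= sz; apply: vmin; split; rewrite // ex.
have [vi shi ei] := sh i (mem_head _ _) wi.
have [vk shk ek] := sh k (mem_last i [:: k]) wk.
have := refl_short shi; have := refl_short shk.
rewrite eqxx eq_sym (negbTE neq_ik) (@refl_word (i :: vi) (k :: vk)) ?ei //.
by lia.
Qed.

End InfiniteDihedral.


(** * Reduced words and descents *)

Lemma not_far i k : i != k -> ~~ far i k -> k = i.+1 :> nat \/ i = k.+1 :> nat.
Proof. by rewrite /far -val_eqE /=; lia. Qed.

Lemma reduced_cons i r : reduced s (i :: r) -> reduced s r.
Proof.
move=> red r' e; have /red /= : 'w (i :: r') = 'w (i :: r) by rewrite !wcons e.
by rewrite ltnS.
Qed.

Lemma reduced_cons_ldescent i r : reduced s (i :: r) -> ldescent ('w r) i = false.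
Proof.
move=> red; apply/negP; rewrite /ldescent cross_word => /crossw_delete[r' [e sz _]].
suff /red : 'w r' = 'w (i :: r) by rewrite /= -sz; lia.
by rewrite wcons.
Qed.

Lemma not_ldescent_reduced i r : reduced s r -> ldescent ('w r) i = false ->
  reduced s (i :: r).
Proof.
move=> red nDL r' e.
have : crossw r' (s i) by rewrite -cross_word e wcons cross_smul; rewrite /ldescent in nDL; rewrite nDL.
move=> /crossw_delete[r1 [e1 <- _]]; rewrite /= ltnS; apply: red.
by rewrite e1 e wcons gen_mulK.
Qed.

(** The first letter [k] of a reduced word is a descent. If [k] differs from the descent [i], the
    two must be far, since neighbouring generators are never both descents; the descent [i] then
    passes to the remaining word. *)
Lemma reduced_descent r i : reduced s r -> ldescent ('w r) i ->
  exists p q, r = p ++ i :: q /\ all (far i) p.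
Proof.
elim: r => [|k r IHr] red; first by rewrite /ldescent wnil cross1.
have [<- _|ki] := eqVneq k i; first by exists [::], r.
have [fik|nfar] := boolP (far i k).
  rewrite /ldescent wcons cross_mul_far // => /(IHr (reduced_cons red))[p [q [-> pq]]].
  by exists (k :: p), q; rewrite /= fik.
have Dk : ldescent ('w (k :: r)) k.
  have := reduced_cons_ldescent red; rewrite /ldescent => nD.
  by rewrite wcons cross_smul nD.
rewrite eq_sym in ki.
by have := adjacent_descents nfar ki ('w (k :: r)); rewrite Dk andbT => /negP.
Qed.

End Words.

(** * Graphs built by adding clones *)

Section Walks.
Variables (T : eqType) (e : rel T).
Implicit Types (P Q : T -> Prop) (x y z : T).

Inductive walk P : nat -> T -> T -> Prop :=
| walk_nil x : P x -> walk P 0 x x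
| walk_cons l x y z : P x -> e x y -> walk P l y z -> walk P l.+1 x z.

Definition connected P := forall x y, P x -> P y -> exists l, walk P l x y.

Lemma walk_mono P Q l x y : (forall v, P v -> Q v) -> walk P l x y -> walk Q l x y.
Proof.
move=> PQ; elim=> [z /PQ|{}l {}x u z /PQ Qx xu _]; first exact: walk_nil.
exact: walk_cons.
Qed.

Lemma walk_start P l x y : walk P l x y -> P x. Proof. by case. Qed.

Lemma walk_end P l x y : walk P l x y -> P y. Proof. by elim. Qed.

Lemma walk_inv P l x z : walk P l x z ->
  [/\ l = 0, x = z & P x] \/
  exists l' y, [/\ l = l'.+1, P x, e x y & walk P l' y z].
Proof.
case=> [|{}l {}x y {}z Px xy yz]; first by left.
by right; exists l, y.
Qed.

Lemma walk_cat P l l' x y z :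
  walk P l x y -> walk P l' y z -> walk P (l + l') x z.
Proof.
move=> xy yz; elim: xy yz => // {}l {}x u v Px xu _ IH /IH.
by rewrite addSn; exact: walk_cons.
Qed.

Lemma walk_rcons P l x y z : walk P l x y -> e y z -> P z -> walk P l.+1 x z.
Proof.
move=> xy yz Pz; rewrite -addn1; apply: walk_cat (xy) _.
by apply: walk_cons yz (walk_nil Pz); exact: walk_end xy.
Qed.

Lemma walk_sym P l x y : symmetric e -> walk P l x y -> walk P l y x.
Proof.
move=> sym; elim=> [z|{}l {}x u z Px xu _ IH]; first exact: walk_nil.
by apply: walk_rcons IH _ Px; rewrite sym.
Qed.

Lemma walk_path P l x y : walk P l x y <->
  exists p, [/\ path e x p, last x p = y, size p = l & forall v, v \in x :: p -> P v].
Proof.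
split=> [|[p [+ + + +]]].
  elim=> [z Pz|{}l {}x u z Px xu _ [p [pp lp sp Pp]]].
    by exists [::]; split=> // v /[!inE]/eqP->.
  exists (u :: p); rewrite /= xu sp; split=> // v.
  by rewrite in_cons => /predU1P[->//|]; apply: Pp.
elim: p x l => [|u p IHp] x l /=.
  by move=> _ <- <- Pp; apply/walk_nil/Pp; rewrite inE.
move=> /andP[xu pp] lp <- Pp; apply: walk_cons xu _; first by apply: Pp; rewrite inE eqxx.
by apply: IHp => // v vp; apply: Pp; rewrite in_cons vp orbT.
Qed.

Lemma connected_add P Q : symmetric e -> connected P -> (forall v, P v -> Q v) ->
  (forall v, Q v -> P v \/ exists2 u, P u & e v u) -> connected Q.
Proof.
move=> sym cP PQ QP.
have near v : Q v -> exists u, P u /\ exists l, walk Q l v u.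
  move=> Qv; have [Pv|[u Pu vu]] := QP v Qv.
    by exists v; split=> //; exists 0; apply: walk_nil.
  exists u; split=> //; exists 1; apply: walk_cons vu (walk_nil _) => //; exact: PQ.
move=> x y /near[x' [Px' [l xx']]] /near[y' [Py' [l' yy']]].
have [m x'y'] := cP _ _ Px' Py'.
exists (l + (m + l')); apply: walk_cat xx' (walk_cat (walk_mono PQ x'y') _).
exact: walk_sym.
Qed.

End Walks.

(** * Incidence as an order ranked by type *)

Section Order.
Variables (n : nat) (G : lgraph n).
Local Notation tp x := (nat_of_ord (@vtype n G x)).
Implicit Types (A B : set G) (a b c d u v x y z : G) (P : G -> Prop).

Definition up u v := edge u v && (vtype v == (vtype u).+1 :> nat).

Lemma up_tp u v : up u v -> tp v = (tp u).+1. Proof. by case/andP=> _ /eqP. Qed.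

Lemma up_edge u v : up u v -> edge u v. Proof. by case/andP. Qed.

Lemma edge_up u v : edge u v -> up u v \/ up v u.
Proof.
move=> uv; rewrite /up [edge v u]edgeC uv /=.
by case: (edge_vtype uv) => ->; [left|right].
Qed.

Lemma edge_tp u v : edge u v -> (tp u).+1 = tp v \/ (tp v).+1 = tp u.
Proof. exact: edge_vtype. Qed.

(** Existence of a dense flag inside [A], in a form suited to induction. *)
Inductive below A : G -> G -> Prop :=
| below_refl x : A x -> below A x x
| below_step x u y : A x -> up x u -> below A u y -> below A x y.

Lemma below_inl A x y : below A x y -> A x. Proof. by case. Qed.
Lemma below_inr A x y : below A x y -> A y. Proof. by elim. Qed.

Lemma below_tp A x y : below A x y -> tp x <= tp y.
Proof. by elim=> // {}x u {}y _ /up_tp xu _; lia. Qed.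

Lemma below_trans A x y z : below A x y -> below A y z -> below A x z.
Proof. by elim=> // {}x u {}y Ax xu _ IH /IH; exact: below_step. Qed.

Lemma up_below A x y : A x -> A y -> up x y -> below A x y.
Proof. by move=> Ax Ay xy; apply: below_step xy (below_refl _). Qed.

Lemma below_eq A x y : below A x y -> tp y <= tp x -> x = y.
Proof. by case=> // {}x u {}y _ /up_tp xu /below_tp; lia. Qed.

Lemma below_first A x y : below A x y -> x = y \/ exists u, up x u /\ below A u y.
Proof. by case=> [|{}x u {}y _ xu uy]; [left|right; exists u]. Qed.

Lemma below_last A x y : below A x y -> x = y \/ exists u, below A x u /\ up u y.
Proof.
elim=> [z|{}x u {}y Ax xu uy [e|[v [uv vy]]]]; first by left.
  by subst u; right; exists x; split=> //; apply: below_refl.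
by right; exists v; split=> //; apply: below_step xu uv.
Qed.

Lemma below_mono A B x y : (forall v, A v -> B v) -> below A x y -> below B x y.
Proof.
move=> AB; elim=> [z /AB|{}x u {}y /AB Bx xu _]; first exact: below_refl.
exact: below_step.
Qed.

Lemma below_walk A x y : below A x y ->
  walk edge (fun v => below A x v /\ below A v y) (tp y - tp x) x y.
Proof.
elim=> [z Az|{}x u {}y Ax xu uy IH].
  by rewrite subnn; apply: walk_nil; split; apply: below_refl.
have xy : below A x y := below_step Ax xu uy.
have -> : tp y - tp x = (tp y - tp u).+1.
  by have := below_tp uy; have := up_tp xu; lia.
apply: walk_cons (up_edge xu) _; first by split=> //; apply: below_refl.
by apply: walk_mono IH => v [uv vy]; split=> //; apply: below_step xu uv.
Qed.

Definition res A a v := below A v a \/ below A a v.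

Definition flag_set A :=
  [/\ forall k, k <= n -> exists x, A x /\ tp x = k,
      forall x y, A x -> A y -> tp x = tp y -> x = y
    & forall x y, A x -> A y -> (tp x).+1 = tp y -> edge x y].

(** The bound [k <= n] accounts for the ends: at type 0 or [n] only one adjacent type exists, so for
    positive [n] the clone has a single neighbour there. *)
Definition clone A y y' : Prop :=
  [/\ A y, ~ A y', vtype y' = vtype y, forall u, A u -> edge y' u -> edge y u &
   (forall u v, A u -> A v -> edge y' u -> edge y' v -> tp u = tp v -> u = v) /\
   (forall k, k <= n -> k.+1 = tp y' \/ k = (tp y').+1 ->
      exists u, [/\ A u, edge y' u & tp u = k])].

Inductive built : set G -> Prop :=
| built_flag A : flag_set A -> built A
| built_clone A y y' : built A -> clone A y y' -> built (y' |` A)%classic.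

Section FlagSet.
Variable A : set G.
Hypothesis flA : flag_set A.

Lemma flag_below x y : A x -> A y -> tp x <= tp y -> below A x y.
Proof.
have [inh inj ed] := flA.
move: {2}(tp y - tp x) (erefl (tp y - tp x)) => d.
elim: d x => [|d IHd] x dE Ax Ay le_xy.
  by have <- : x = y; [apply: inj => //; lia|exact: below_refl].
have [u [Au uE]] : exists u, A u /\ tp u = (tp x).+1.
  by apply: inh; have := ltn_ord (vtype y); lia.
apply: (@below_step _ _ u) => //; first by rewrite /up ed ?uE ?eqxx.
by apply: IHd => //; lia.
Qed.

Lemma flag_connected P i : (forall v, P v -> A v /\ (tp v = i.-1 \/ tp v = i)) ->
  connected edge P.
Proof.
have [inh inj ed] := flA.
move=> PA x y Px Py; have [Ax xE] := PA x Px; have [Ay yE] := PA y Py.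
have [exy|nexy] := eqVneq (tp x) (tp y).
  by rewrite (inj x y Ax Ay exy); exists 0; apply: walk_nil.
exists 1; apply: walk_cons (walk_nil _ Py) => //.
have [lt_xy|lt_yx|/eqP] := ltngtP (tp x) (tp y); last by rewrite (negbTE nexy).
  by apply: ed => //; lia.
by rewrite edgeC; apply: ed => //; lia.
Qed.

End FlagSet.

(** * Order and folding for a single clone *)

Section Clone.
Variables (A : set G) (y y' : G).
Hypothesis cl : clone A y y'.
Local Notation B := (y' |` A)%classic.

Lemma clone_in v : B v -> v = y' \/ A v. Proof. by []. Qed.
Lemma clone_new : B y'. Proof. by left. Qed.
Lemma clone_sub v : A v -> B v. Proof. by right. Qed.
Hint Resolve clone_new clone_sub : core.

Lemma clone_neq v : A v -> v <> y'. Proof. by case: cl => _ nA _ _ _ + e; rewrite e. Qed.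

Lemma clone_neqb v : A v -> (v == y') = false.
Proof. by move=> /clone_neq /eqP /negbTE. Qed.

Lemma clone_tp : tp y' = tp y. Proof. by case: cl => _ _ ->. Qed.

Lemma clone_orig : A y. Proof. by case: cl. Qed.

Lemma clone_nbr u : B u -> edge y' u -> A u.
Proof. by case=> // -> /edge_tp; lia. Qed.

Lemma clone_edge u : A u -> edge y' u -> edge y u. Proof. by case: cl => _ _ _ + _; apply. Qed.

Lemma clone_uniq u v : A u -> A v -> edge y' u -> edge y' v -> tp u = tp v -> u = v.
Proof. by case: cl => _ _ _ _ [+ _]; apply. Qed.

Lemma clone_lower : 0 < tp y' -> exists x, A x /\ up x y'.
Proof.
case: cl => _ _ _ _ [_ ex] gt0.
have [||x [Ax ed xE]] := ex (tp y').-1; [by have := ltn_ord (vtype y'); lia|by left; lia|].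
by exists x; rewrite /up edgeC ed; split=> //=; lia.
Qed.

Lemma clone_upper : tp y' < n -> exists z, A z /\ up y' z.
Proof.
case: cl => _ _ _ _ [_ ex] ltn.
have [||z [Az ed zE]] := ex (tp y').+1; [by []|by right|].
by exists z; rewrite /up ed zE /=.
Qed.

Lemma lower_uniq x x1 : A x -> A x1 -> up x y' -> up x1 y' -> x = x1.
Proof.
move=> Ax Ax1 u1 u2; have := up_tp u1; have := up_tp u2.
move: u1 u2 => /up_edge + /up_edge; rewrite edgeC => e1; rewrite edgeC => e2 t1 t2.
by apply: clone_uniq => //; lia.
Qed.

Lemma upper_uniq x x1 : A x -> A x1 -> up y' x -> up y' x1 -> x = x1.
Proof.
move=> Ax Ax1 u1 u2; have := up_tp u1; have := up_tp u2.
move: u1 u2 => /up_edge e1 /up_edge e2 t1 t2.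
by apply: clone_uniq => //; lia.
Qed.

Lemma up_lower x : A x -> up x y' -> up x y.
Proof.
move=> Ax /andP[ed /eqP xE]; rewrite /up edgeC clone_edge //; last by rewrite edgeC.
by rewrite -clone_tp xE eqxx.
Qed.

Lemma up_upper x : A x -> up y' x -> up y x.
Proof. by move=> Ax /andP[ed /eqP xE]; rewrite /up clone_edge //= -clone_tp xE. Qed.

Definition fold_clone v := if v == y' then y else v.

Lemma fold_old v : A v -> fold_clone v = v.
Proof. by move=> Av; rewrite /fold_clone clone_neqb. Qed.

Lemma fold_new : fold_clone y' = y. Proof. by rewrite /fold_clone eqxx. Qed.

Lemma fold_in v : B v -> A (fold_clone v).
Proof. by case=> [->|Av]; [rewrite fold_new; exact: clone_orig|rewrite fold_old]. Qed.

Lemma fold_up u v : B u -> B v -> up u v -> up (fold_clone u) (fold_clone v).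
Proof.
move=> Bu Bv uv; case: (Bu) => [e|Au]; case: (Bv) => [e'|Av].
- by move: (up_tp uv); rewrite e e'; lia.
- by rewrite e fold_new fold_old // up_upper // -e.
- by rewrite e' fold_new fold_old // up_lower // -e'.
- by rewrite !fold_old.
Qed.

Lemma below_fold a b : below B a b -> below A (fold_clone a) (fold_clone b).
Proof.
elim=> [x /fold_in|x u z Bx xu uz IH]; first exact: below_refl.
apply: below_step (fold_in Bx) (fold_up _ _ xu) IH => //; exact: below_inl uz.
Qed.

(** Folding [y'] onto [y] is an order-preserving retraction onto [A], so the clone creates no
    incidence between old vertices. *)
Lemma below_old a b : A a -> A b -> below B a b <-> below A a b.
Proof.
move=> Aa Ab; split=> [/below_fold|]; first by rewrite !fold_old.
exact: below_mono clone_sub.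
Qed.

Lemma below_to_new a : A a -> below B a y' <-> exists x, [/\ A x, up x y' & below A a x].
Proof.
move=> Aa; split=> [/below_last[/(clone_neq Aa)//|[u [au uy]]]|[x [Ax xy ax]]].
  have Au : A u.
    by apply: clone_nbr; [exact: below_inr au|rewrite edgeC; exact: up_edge].
  by exists u; split=> //; apply/below_old.
apply: below_trans (up_below _ _ xy) => //; last exact: clone_sub.
exact/below_old.
Qed.

Lemma below_from_new b : A b -> below B y' b <-> exists z, [/\ A z, up y' z & below A z b].
Proof.
move=> Ab; split=> [|[z [Az yz zb]]].
  case/below_first=> [e|[u [yu ub]]]; first by case: (clone_neq Ab).
  have Au : A u by apply: clone_nbr; [exact: below_inl ub|exact: up_edge].
  by exists u; split=> //; apply/below_old.
apply: below_trans (up_below _ _ yz) _ => //; first exact: clone_sub.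
exact/below_old.
Qed.

End Clone.

End Order.

(** * Meets, absence of cycles and connectedness *)

Section Invariants.
Variables (n : nat) (G : lgraph n).
Local Notation tp x := (nat_of_ord (@vtype n G x)).
Local Notation clone_set A y := (y |` A)%classic.
Implicit Types (A B : set G) (a b c d u v x y z : G) (P : G -> Prop).

Lemma built_finite A : built A -> finite_set A.
Proof.
elim=> {A} [A [inh inj _]|A y y' _ IH _]; last by rewrite finite_setU; split.
have /choice[f fP] (k : 'I_n.+1) : exists x, A x /\ tp x = k.
  by apply: inh; have := ltn_ord k; lia.
apply: (@sub_finite_set _ _ (range f)); last exact: finite_image.
move=> x Ax; exists (vtype x) => //.
by have [Af fE] := fP (vtype x); apply: inj.
Qed.

Lemma built_types A : built A -> forall k, k <= n -> exists x, A x /\ tp x = k.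
Proof.
elim=> {A} [A [inh _ _] //|A y y' _ IH _] k /IH[x [Ax xE]].
by exists x; split=> //; right.
Qed.

Lemma built_nbr A : built A -> forall v k, A v -> k <= n ->
  k.+1 = tp v \/ k = (tp v).+1 -> exists u, [/\ A u, edge v u & tp u = k].
Proof.
elim=> {A} [A [inh _ ed] v k Av le_k kE|A y y' _ IH cl v k [->|Av] le_k kE].
- have [u [Au uE]] := inh k le_k; exists u; split=> //.
  by case: kE => kE; [rewrite edgeC|]; apply: ed => //; lia.
- case: cl => _ _ _ _ [_ ex]; have [u [Au uE ed]] := ex k le_k kE.
  by exists u; split=> //; right.
- have [u [Au uE ed]] := IH v k Av le_k kE.
  by exists u; split=> //; right.
Qed.

Definition has_glb A := forall a b c, below A c a -> below A c b ->
  exists m, [/\ below A m a, below A m b & forall d, below A d a -> below A d b -> below A d m].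

(** In a flag the smaller element is the meet. After cloning, the meet of two old elements survives:
    if [y'] lies below both, so does its unique upper neighbour, which is then below the meet. *)
Lemma built_glb A : built A -> has_glb A.
Proof.
elim=> {A} [A flA|A y y' bA IH cl] a b c ca cb.
  have [Aa Ab] := (below_inr ca, below_inr cb).
  wlog le_ab : a b ca cb Aa Ab / tp a <= tp b.
    move=> H; have [le_ab|lt_ba] := leqP (tp a) (tp b); first exact: H.
    have [m [m1 m2 m3]] := H b a cb ca Ab Aa (ltnW lt_ba).
    by exists m; split=> // d da db; exact: m3.
  exists a; split; [exact: below_refl|exact: flag_below|by []].
have [Ba Bb] := (below_inr ca, below_inr cb).
have new m d : below (clone_set A y') d y' -> d = y' \/ exists x, [/\ A x, up x y' & below A d x].
  move=> dy; have [->|Ad] := clone_in (below_inl dy); first by left.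
  by right; apply/(below_to_new cl Ad).
(* unless y' is below b, the common lower bounds of y' and b are those of b and the
   lower neighbour of y' *)
have low b0 c0 : A b0 -> ~ below (clone_set A y') y' b0 ->
    below (clone_set A y') c0 y' -> below (clone_set A y') c0 b0 ->
    exists m, [/\ below (clone_set A y') m y', below (clone_set A y') m b0 &
      forall d, below (clone_set A y') d y' -> below (clone_set A y') d b0 ->
        below (clone_set A y') d m].
  move=> Ab0 ny c0y c0b.
  have Ac0 : A c0 by have [e|//] := clone_in (below_inl c0y); subst c0.
  have [x [Ax xy c0x]] := (below_to_new cl Ac0).1 c0y.
  have [m [mx mb mmax]] := IH x b0 c0 c0x ((below_old cl Ac0 Ab0).1 c0b).
  have Am := below_inl mx.
  exists m; split.
  - by apply/(below_to_new cl Am); exists x.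
  - exact/(below_old cl).
  move=> d dy db; have Ad : A d by have [e|//] := clone_in (below_inl dy); subst d.
  have [x1 [Ax1 x1y dx1]] := (below_to_new cl Ad).1 dy.
  rewrite -(lower_uniq cl Ax Ax1 xy x1y) in dx1.
  by apply/(below_old cl Ad Am)/mmax => //; apply/(below_old cl).
case: (clone_in Ba) => [ea|Aa]; case: (clone_in Bb) => [eb|Ab].
- subst a b; exists y'; split=> //; exact: below_refl (clone_new _ _).
- subst a; have [yb|nyb] := pselect (below (clone_set A y') y' b).
    by exists y'; split=> //; exact: below_refl (clone_new _ _).
  exact: low ca cb.
- subst b; have [ya|nya] := pselect (below (clone_set A y') y' a).
    by exists y'; split=> //; exact: below_refl (clone_new _ _).
  have [m [m1 m2 m3]] := low _ _ Aa nya cb ca.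
  by exists m; split=> // d da db; exact: m3.
(* A common lower bound that is the clone itself is replaced by its upper neighbour, so that the
   induction hypothesis applies in [A]. *)
have [c1 [c1a c1b]] : exists c1, below A c1 a /\ below A c1 b.
  have [e|Ac] := clone_in (below_inl ca); last by exists c; split; apply/(below_old cl).
  subst c; have [z [Az yz za]] := (below_from_new cl Aa).1 ca.
  have [z1 [Az1 yz1 z1b]] := (below_from_new cl Ab).1 cb.
  by exists z; split=> //; rewrite (upper_uniq cl Az Az1 yz yz1).
have [m [ma mb mmax]] := IH _ _ _ c1a c1b; have Am := below_inl ma.
exists m; split; [exact/(below_old cl)|exact/(below_old cl)|move=> d da db].
have [e|Ad] := clone_in (below_inl da); last first.
  by apply/(below_old cl Ad Am)/mmax; apply/(below_old cl).
subst d; have [z [Az yz za]] := (below_from_new cl Aa).1 da.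
have [z1 [Az1 yz1 z1b]] := (below_from_new cl Ab).1 db.
apply/(below_from_new cl Am); exists z; split=> //; apply: mmax => //.
by rewrite (upper_uniq cl Az Az1 yz yz1).
Qed.

(** In a flag, two of any three vertices of only two types coincide. A cycle through the clone would
    use two neighbours of it of the same type, and these are equal. *)
Lemma built_no_Ecycle A i s : built A -> ~ Ecycle A i s.
Proof.
move=> bA; elim: bA s => {A} [A [_ inj _]|A y y' bA IH cl] s [[sz /andP[cyc un] sA] sT].
  case: s sz cyc un sA sT => [|x [|y [|z s]]] //= _ _ un sA sT.
  have Ax : A x by apply: sA; rewrite /= inE eqxx.
  have Ay : A y by apply: sA; rewrite /= !inE eqxx orbT.
  have Az : A z by apply: sA; rewrite /= !inE eqxx !orbT.
  have tx : tp x = i.-1 \/ tp x = i by apply: sT; rewrite inE eqxx.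
  have ty : tp y = i.-1 \/ tp y = i by apply: sT; rewrite !inE eqxx orbT.
  have tz : tp z = i.-1 \/ tp z = i by apply: sT; rewrite !inE eqxx !orbT.
  have : [\/ tp x = tp y, tp x = tp z | tp y = tp z].
    by case: tx ty tz => -> [] -> [] ->;
      first [by constructor 1|by constructor 2|by constructor 3].
  by case=> /inj e; move: un; rewrite e // !inE eqxx ?orbT ?andbF.
have [ys|ys] := boolP (y' \in s); last first.
  apply: (IH s); split=> //; split=> //; first exact/andP.
  by move=> v vs; case: (clone_in (sA v vs)) => // e; rewrite -e (vs : v \in s) in ys.
have [j p rE] := rot_to ys.
move: sz cyc un sA sT; rewrite -(size_rot j) -(rot_cycle j) -(rot_uniq j).
move=> + + + sA sT; have {}sA v : v \in rot j s -> (clone_set A y') v.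
  by rewrite mem_rot => /sA.
have {}sT v : v \in rot j s -> tp v = i.-1 \/ tp v = i by rewrite mem_rot => /sT.
rewrite {}rE in sA sT *; case: p sA sT => [|b [|b1 q]] // sA sT _.
rewrite (cycle_path y') [last _ _]/= => /and3P[by' yb _] /and3P[_ nb _].
have b'q : last b1 q \in b1 :: q by apply: mem_last.
have ne_b : b != last b1 q by apply: contraNneq nb => ->.
have bM : b \in [:: y', b, b1 & q] by rewrite !inE eqxx orbT.
have b'M : last b1 q \in [:: y', b, b1 & q] by rewrite in_cons in_cons b'q !orbT.
rewrite edgeC in by'.
have Ab := clone_nbr (sA _ bM) yb; have Ab' := clone_nbr (sA _ b'M) by'.
apply: (negP ne_b); apply/eqP/(clone_uniq cl Ab Ab' yb by').
have same (t t1 t2 : nat) : t.+1 = t1 \/ t1.+1 = t -> t.+1 = t2 \/ t2.+1 = t ->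
  t = i.-1 \/ t = i -> t1 = i.-1 \/ t1 = i -> t2 = i.-1 \/ t2 = i -> t1 = t2.
  by lia.
by apply: (same (tp y')); [exact: edge_tp|exact: edge_tp|apply: sT..]; rewrite ?mem_head.
Qed.

Definition level P i v := P v /\ (tp v = i.-1 \/ tp v = i).

Lemma built_connected A i : built A -> 0 < i <= n -> connected edge (level A i).
Proof.
move=> + /andP[i0 le_in]; elim=> {A} [A flA|A y y' bA IH cl].
  by apply: (flag_connected (i := i) flA) => v [].
apply: connected_add (@edgeC _ G) IH _ _ => [v [Av vT]|v [[->|Av] vT]].
- by split=> //; right.
- right; case: vT => vT.
    have [|z [Az yz]] := clone_upper cl; first by lia.
    exists z; last exact: up_edge.
    by split=> //; right; have := up_tp yz; lia.
  have [|x [Ax xy]] := clone_lower cl; first by lia.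
  exists x; last by rewrite edgeC; exact: up_edge.
  by split=> //; left; have := up_tp xy; lia.
by left.
Qed.

(** The chain runs through the original vertex [y]. *)
Lemma below_lower_upper A y y' x z : clone A y y' -> A x -> up x y' -> A z -> up y' z ->
  below A x z.
Proof.
move=> cl Ax xy Az yz; apply: (below_step Ax (up_lower cl Ax xy)).
by apply: up_below (up_upper cl Az yz) => //; apply: clone_orig cl.
Qed.

(** If [a] is old and [y'] enters its residue, then the neighbours of [y'] in the adjacent types lie
    there too, so [y'] is attached to the old level. *)
Lemma built_res_connected A i a : built A -> A a -> 0 < i <= n ->
  connected edge (level (res A a) i).
Proof.
move=> + + /andP[i0 le_in] => bA; elim: bA a => {A} [A flA|A y y' bA IH cl] a.
  by move=> Aa; apply: (flag_connected (i := i) flA) => v [[/below_inl|/below_inr] Av vT].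
have old v u : A v -> A u -> res (clone_set A y') u v <-> res A u v.
  by move=> Av Au; split=> -[h|h]; [left|right|left|right]; apply/(below_old cl).
case=> [->|Aa]; last first.
  apply: connected_add (@edgeC _ G) (IH a Aa) _ _ => [v [va vT]|v [va vT]].
    by split=> //; apply/old => //; case: va => [/below_inl|/below_inr].
  have : clone_set A y' v by case: va => [/below_inl|/below_inr].
  case/clone_in=> [e|Av]; last by left; split=> //; apply/old.
  right; subst v.
  suff [vup vlow] : (tp y' < n -> exists z, [/\ A z, up y' z & res A a z]) /\
     (0 < tp y' -> exists z, [/\ A z, up z y' & res A a z]).
    case: vT => vT.
      have [|z [Az yz za]] := vup; first by lia.
      by exists z; [split=> //; right; rewrite (up_tp yz); lia|exact: up_edge].
    have [|z [Az yz za]] := vlow; first by lia.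
    exists z; last by rewrite edgeC; exact: up_edge.
    by split=> //; left; have := (up_tp yz); lia.
  case: va => [/(below_from_new cl Aa)[z [Az yz za]]|/(below_to_new cl Aa)[x [Ax xy ax]]].
    split=> lt; first by exists z; split=> //; left.
    have [x [Ax xy]] := clone_lower cl lt; exists x; split=> //; left.
    exact: below_trans (below_lower_upper cl Ax xy Az yz) za.
  split=> lt; last by exists x; split=> //; right.
  have [z [Az yz]] := clone_upper cl lt; exists z; split=> //; right.
  exact: below_trans ax (below_lower_upper cl Ax xy Az yz).
(* Residue of the clone itself: a level strictly below or above [y'] is the level of the residue of
   its lower or upper neighbour; a level containing the type of [y'] is a star around [y']. *)
have [lt_i|gt_i|e_i] := ltngtP i (tp y').
- have [|x [Ax xy]] := clone_lower cl; first by lia.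
  apply: connected_add (@edgeC _ G) (IH x Ax) _ _ => [v [vx vT]|v [vy vT]].
    have Av : A v by case: vx => [/below_inl|/below_inr].
    split=> //; left; apply/(below_to_new cl Av); exists x; split=> //.
    case: vx => // xv; rewrite (below_eq xv); first exact: below_refl.
    by have := up_tp xy; lia.
  left; split=> //; case: vy => [vy|/below_tp]; last by lia.
  have [e|Av] := clone_in (below_inl vy); first by subst v; lia.
  have [x1 [Ax1 x1y vx1]] := (below_to_new cl Av).1 vy.
  by left; rewrite (lower_uniq cl Ax Ax1 xy x1y).
- have [lt_i|ge_i] := ltnP (tp y') i.-1.
    have [|x [Ax xy]] := clone_upper cl; first by lia.
    apply: connected_add (@edgeC _ G) (IH x Ax) _ _ => [v [vx vT]|v [vy vT]].
      have Av : A v by case: vx => [/below_inl|/below_inr].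
      split=> //; right; apply/(below_from_new cl Av); exists x; split=> //.
      case: vx => // xv; rewrite (below_eq xv); first exact: below_refl.
      by have := up_tp xy; lia.
    left; split=> //; case: vy => [/below_tp|vy]; first by lia.
    have [e|Av] := clone_in (below_inr vy); first by subst v; lia.
    have [x1 [Ax1 x1y vx1]] := (below_from_new cl Av).1 vy.
    by right; rewrite (upper_uniq cl Ax Ax1 xy x1y).
  apply: (@connected_add _ _ (eq y') _ (@edgeC _ G)) => [v w <- <-|v <-|v [vy vT]].
  + by exists 0; apply: walk_nil.
  + by split; [left; apply: below_refl; left|left; lia].
  have [vy'|ne_v] := eqVneq v y'; [by left|right; exists y' => //].
  have le_yv : below (clone_set A y') y' v.
    case: vy => // vy; have le_v := below_tp vy.
    by move: ne_v; rewrite (below_eq vy) ?eqxx //; lia.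
  have [e|Av] := clone_in (below_inr le_yv); first by rewrite e eqxx in ne_v.
  have [z [Az yz zv]] := (below_from_new cl Av).1 le_yv.
  rewrite -(below_eq zv); first by rewrite edgeC; exact: up_edge.
  by rewrite (up_tp yz); lia.
apply: (@connected_add _ _ (eq y') _ (@edgeC _ G)) => [v w <- <-|v <-|v [vy vT]].
- by exists 0; apply: walk_nil.
- by split; [left; apply: below_refl; left|right; lia].
have [vy'|ne_v] := eqVneq v y'; [by left|right; exists y' => //].
have le_yv : below (clone_set A y') v y'.
  case: vy => // vy; have le_v := below_tp vy.
  by move: ne_v; rewrite -(below_eq vy) ?eqxx //; lia.
have [e|Av] := clone_in (below_inl le_yv); first by rewrite e eqxx in ne_v.
have [z [Az yz zv]] := (below_to_new cl Av).1 le_yv.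
rewrite (below_eq zv); first exact: up_edge.
by have := up_tp yz; lia.
Qed.

End Invariants.

(** * Cycle reduction and membership in the class K' *)

Section Reduction.
Variables (n : nat) (G : lgraph n).
Local Notation tp x := (nat_of_ord (@vtype n G x)).
Local Notation clone_set A y := (y |` A)%classic.
Implicit Types (A B : set G) (a b c d u v x y z : G) (P S : G -> Prop).

Lemma walk_tp P l x z : walk edge P l x z -> tp x <= l + tp z.
Proof. by elim=> // {}l {}x y {}z _ /edge_tp + _; lia. Qed.

(** Each edge changes the type by one, so a walk reaching type [k] has at least [k - tp x] edges
    before that point and [k - tp z] after it. *)
Lemma walk_level P l x z k : walk edge P l x z ->
  walk edge (fun v => P v /\ tp v < k) l x z \/ k + k <= l + tp x + tp z.
Proof.
elim=> [{}x Px|{}l {}x y {}z Px xy yz IH].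
  by have [ltk|gek] := ltnP (tp x) k; [left; apply: walk_nil|right; lia].
have [ltk|gek] := ltnP (tp x) k; last first.
  by right; have := walk_tp yz; have := edge_tp xy; lia.
case: IH => [IH|IH]; first by left; apply: walk_cons IH.
by right; have := edge_tp xy; lia.
Qed.

(** Conditions on the vertices of the given walk; those of the new one are in [res_walk]. The set
    [S] will be the vertex set of the cycle, from which the vertices of the extreme type [h] have to
    come. *)
Definition out_walk A a h S v :=
  [/\ A v, v <> a, h <= tp v <= tp a & tp v = h -> S v].

Definition res_walk A a h S v :=
  [/\ below A v a, h <= tp v < tp a & tp v = h -> S v].

(* Condition (4) in the form in which it propagates along clones: the endpoints are
   arbitrary elements below a, and the new walk is not longer than the old one. *)
Definition walks_reduce A := forall a c c' h S l, below A c a -> below A c' a ->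
  walk edge (out_walk A a h S) l c c' ->
  exists2 l', l' <= l & walk edge (res_walk A a h S) l' c c'.

Section Step.
Variables (A : set G) (y y' : G) (cl : clone A y y').
Hypothesis IH : walks_reduce A.
Local Notation B := (clone_set A y').

(** Both ends lie below the lower neighbour [x] of [y']. A walk staying under the type of [x] avoids
    [x], and induction applies to [x]. Any other walk is at least as long as the climb from [c] to
    [x] followed by the descent to [c']. *)
Lemma walks_reduce_new c c' h S l : below B c y' -> below B c' y' ->
  walk edge (out_walk B y' h S) l c c' ->
  exists2 l', l' <= l & walk edge (res_walk B y' h S) l' c c'.
Proof.
move=> cy cy' w.
have inA v : out_walk B y' h S v -> A v by case=> /clone_in[].
have [Ac Ac'] := (inA _ (walk_start w), inA _ (walk_end w)).
have [x [Ax xy cx]] := (below_to_new cl Ac).1 cy.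
have [x1 [Ax1 x1y cx']] := (below_to_new cl Ac').1 cy'.
rewrite -(lower_uniq cl Ax Ax1 xy x1y) in cx'.
have le_new v : below A v x -> below B v y'.
  by move=> vx; apply/(below_to_new cl (below_inl vx)); exists x.
have tx := up_tp xy.
have [w1|long] := walk_level (tp x) w.
  have wA : walk edge (out_walk A x h S) l c c'.
    apply: walk_mono w1 => v [pv vx]; have Av := inA v pv.
    case: pv => _ _ vT vS; split=> // [e|]; last by lia.
    by subst v; rewrite ltnn in vx.
  have [l' le_l w'] := IH cx cx' wA.
  exists l' => //; apply: walk_mono w' => v [/le_new vy vT vS]; split=> //; lia.
have seg d : below A d x -> out_walk B y' h S d ->
    walk edge (res_walk B y' h S) (tp x - tp d) d x.
  move=> dx [_ _ dT dS]; apply: walk_mono (below_walk dx) => v [dv vx].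
  have [dv' vx'] := (below_tp dv, below_tp vx).
  split; [exact: le_new|lia|move=> vh].
  (* Only the starting vertex of an ascending chain can have the minimal type [h]. *)
  have e : d = v by apply: (below_eq dv); lia.
  by subst v; exact: dS.
have w1 := seg _ cx (walk_start w); have w2 := seg _ cx' (walk_end w).
exists ((tp x - tp c) + (tp x - tp c')).
  by have := below_tp cx; have := below_tp cx'; lia.
exact: walk_cat w1 (walk_sym (@edgeC _ _) w2).
Qed.

(** At a visit to [y'] between [c] and [d], equal types force [c = d] and the detour is cut out.
    Otherwise [y] replaces [y']; its type lies strictly between those of [c] and [d], so [y] is
    neither [a] nor of type [h]. *)
Lemma fold_walk a h S l c c' : A a -> A c -> A c' ->
  walk edge (out_walk B a h S) l c c' ->
  exists2 l', l' <= l & walk edge (out_walk A a h S) l' c c'.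
Proof.
move=> Aa; move: {2}l (leqnn l) => m; elim: m l c => [|m IHm] l c.
  rewrite leqn0 => /eqP-> Ac Ac' /walk_inv[[_ <- [_ ca cT cS]]|[l' [d [//]]]].
  by exists 0 => //; apply: walk_nil.
move=> lem Ac Ac' /walk_inv[[l0 <- [_ ca cT cS]]|[l1 [d [l1E pc cd w]]]].
  by exists 0 => //; apply: walk_nil.
have pc' : out_walk A a h S c by case: pc.
case: (clone_in (let: And4 Bd _ _ _ := walk_start w in Bd)) => [ed|Ad]; last first.
  have [|l' le_l' w'] := IHm l1 d _ Ad Ac' w; first by lia.
  by exists l'.+1; [lia|apply: walk_cons cd w'].
subst d; have py := walk_start w.
case/walk_inv: w => [[_ e _]|[l2 [d [l2E _ yd w]]]]; first by case: (clone_neq cl Ac').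
have pd := walk_start w.
have Ad : A d by apply: (clone_nbr _ yd); case: pd.
have [|l' le_l' w'] := IHm l2 d _ Ad Ac' w; first by lia.
rewrite edgeC in cd.
have [e|ne] := eqVneq (tp c) (tp d).
  by rewrite (clone_uniq cl Ac Ad cd yd e); exists l' => //; lia.
exists l'.+2; first by lia.
have yc := clone_edge cl Ac cd; have yd' := clone_edge cl Ad yd.
apply: walk_cons pc' _ (walk_cons _ yd' w'); first by rewrite edgeC.
case: pc py pd => _ _ cT _ [_ _ yT _] [_ _ dT _].
have := edge_tp cd; have := edge_tp yd; have ty := clone_tp cl => t1 t2.
split; [exact: clone_orig cl| |lia|lia].
by move=> e; rewrite -e in cT yT dT; lia.
Qed.

(** Between old endpoints the walk is folded and the induction hypothesis used. An endpoint [y'] is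
    split off, the next vertex being old and still below [a]. *)
Lemma walks_reduce_old a c c' h S l : A a -> below B c a -> below B c' a ->
  walk edge (out_walk B a h S) l c c' ->
  exists2 l', l' <= l & walk edge (res_walk B a h S) l' c c'.
Proof.
move=> Aa.
pose goal c c' l := exists2 l', l' <= l & walk edge (res_walk B a h S) l' c c'.
have base d d' k : A d -> A d' -> below B d a -> below B d' a ->
    walk edge (out_walk B a h S) k d d' -> goal d d' k.
  move=> Ad Ad' da da' /(fold_walk Aa Ad Ad')[k1 le_k1].
  move=> /(IH ((below_old cl Ad Aa).1 da) ((below_old cl Ad' Aa).1 da'))[k2 le_k2 w].
  exists k2; first by lia.
  by apply: walk_mono w => v [va vT vS]; split=> //; apply: below_mono va; right.
(* y' < a forces both neighbours of y' below a *)
have nbr d : below B y' a -> out_walk B a h S d -> edge y' d -> A d /\ below B d a.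
  move=> ya [Bd da dT _] yd; have Ad := clone_nbr Bd yd; split=> //.
  have [yd'|dy] := edge_up yd; last by apply: below_trans ya; apply: up_below => //; left.
  have [z [Az yz za]] := (below_from_new cl Aa).1 ya.
  by rewrite (upper_uniq cl Ad Az yd' yz); apply/(below_old cl).
have res_of d : below B d a -> out_walk B a h S d -> res_walk B a h S d.
  move=> da [_ ne dT dS]; split=> //; have := below_tp da.
  have : ~ tp a <= tp d by move/(below_eq da).
  lia.
have half d d' k : A d' -> below B d a -> below B d' a ->
    walk edge (out_walk B a h S) k d d' -> goal d d' k.
  move=> Ad' da da' w; have pd := walk_start w.
  case: (clone_in (below_inl da)) => [e|Ad]; last exact: base w.
  subst d; case/walk_inv: w => [[_ e _]|[k1 [d1 [k1E _ yd1 w]]]].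
    by case: (clone_neq cl Ad').
  have [Ad1 d1a] := nbr d1 da (walk_start w) yd1.
  have [k2 le_k2 w2] := base _ _ _ Ad1 Ad' d1a da' w.
  by exists k2.+1; [lia|apply: walk_cons yd1 w2; exact: res_of].
have goal_sym d d' k : goal d d' k -> goal d' d k.
  by case=> k' le_k' w; exists k' => //; apply: walk_sym => //; exact: edgeC.
move=> ca ca' w; have pc := walk_start w.
case: (clone_in (below_inl ca)) => [e|Ac]; last first.
  by apply: goal_sym; apply: half => //; apply: walk_sym w; exact: edgeC.
subst c; case/walk_inv: w => [[-> <- _]|[k1 [d1 [k1E _ yd1 w]]]].
  by exists 0 => //; apply: walk_nil; exact: res_of.
have [Ad1 d1a] := nbr d1 ca (walk_start w) yd1.
have [k2 le_k2 w2] : goal d1 c' k1.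
  by apply: goal_sym; apply: half => //; apply: walk_sym w; exact: edgeC.
by exists k2.+1; [lia|apply: walk_cons yd1 w2; exact: res_of].
Qed.

End Step.

Lemma built_walks_reduce A : built A -> walks_reduce A.
Proof.
elim=> {A} [A flA|A y y' bA IH cl] a c c' h S l ca ca' w.
  exists l => //; have Aa := below_inr ca; apply: walk_mono w => v [Av va vT vS].
  have va' : below A v a by apply: flag_below => //; lia.
  split=> //; have : ~ tp a <= tp v by move/(below_eq va').
  lia.
case: (clone_in (below_inr ca)) => [e|Aa]; last exact: (walks_reduce_old cl IH Aa ca ca' w).
by subst a; exact: (walks_reduce_new cl IH ca ca' w).
Qed.

End Reduction.

(** * Reversal of types *)

Section Dual.
Variables (n : nat) (G : lgraph n).
Implicit Types (A B : set G) (u v x y : G).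

Lemma dual_edge_vtype x y : edge x y ->
  (rev_ord (vtype x)).+1 = rev_ord (vtype y) :> nat \/
  (rev_ord (vtype y)).+1 = rev_ord (vtype x) :> nat.
Proof.
move=> /edge_tp; rewrite /=.
by have := ltn_ord (vtype x); have := ltn_ord (vtype y); lia.
Qed.

(** Exchanges intersecting with generating and the downward with the upward cycle condition, so only
    one of each pair needs a direct proof. *)
Definition dual : lgraph n :=
  @LGraph n (vertex G) (fun x => rev_ord (vtype x)) (@edge n G) (@edgeC n G)
    dual_edge_vtype.

Lemma dual_tp x : nat_of_ord (@vtype n dual x) = n - @vtype n G x.
Proof. exact: subSS. Qed.

Lemma up_dual u v : @up n dual u v = @up n G v u.
Proof.
rewrite /up !dual_tp [edge u v]edgeC; congr (_ && _).
by have := ltn_ord (@vtype n G u); have := ltn_ord (@vtype n G v); lia.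
Qed.

Lemma below_dual A x y : @below n dual A x y <-> below A y x.
Proof.
split; elim=> {x y} [z Az|z u w Az zu _ IH].
- exact: below_refl.
- apply: (below_trans IH); apply: up_below => //; first exact: below_inr IH.
  by rewrite -up_dual.
- exact: (@below_refl _ dual).
apply: (@below_trans _ dual _ _ _ _ IH); apply: (@up_below _ dual) => //.
  exact: below_inr IH.
by rewrite up_dual.
Qed.

Lemma clone_dual A y y' : clone A y y' -> @clone n dual A y y'.
Proof.
case=> Ay nA ty sub [un ex]; split=> //; first by rewrite /= ty.
have tn v : @vtype n G v <= n by have := ltn_ord (@vtype n G v).
split=> [u v Au Av yu yv|k le_k].
  by rewrite !dual_tp => e; apply: un => //; have := tn u; have := tn v; lia.
rewrite dual_tp => kE; have := tn y'.
case: (ex (n - k)) => [||u [Au yu uE] ty']; [lia|have := tn y'; lia|].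
by exists u; split=> //; rewrite dual_tp uE; lia.
Qed.

Lemma built_dual A : built A -> @built n dual A.
Proof.
have tn v : @vtype n G v <= n by have := ltn_ord (@vtype n G v).
elim=> {A} [A [inh inj ed]|A y y' _ IH cl]; last first.
  by apply: (@built_clone _ dual _ y) => //; exact: clone_dual.
apply: built_flag; split=> [k le_k|x y Ax Ay|x y Ax Ay].
- have [|x [Ax xE]] := inh (n - k); first by lia.
  by exists x; rewrite dual_tp xE; split=> //; lia.
- by rewrite !dual_tp => e; apply: inj => //; have := tn x; have := tn y; lia.
rewrite !dual_tp => e; rewrite edgeC; apply: ed => //.
by have := tn x; have := tn y; lia.
Qed.

End Dual.

(** * From the order to incidence, shadows and cycles *)

Section Incidence.
Variables (n : nat) (G : lgraph n).
Local Notation tp x := (nat_of_ord (@vtype n G x)).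
Implicit Types (A B : set G) (a b c u v x y : G).
Local Open Scope classical_set_scope.

Lemma dense_flag_below A x y :
  (exists p, dense_flag A (x :: p) /\ last x p = y) <-> below A x y.
Proof.
split=> [[p [[+ + +] <-]]|].
  elim: p x => [|u p IHp] x pA /=.
    by move=> _ _; apply: below_refl; apply: pA; rewrite /= inE.
  move=> /andP[xu pp] /andP[tu tp].
  apply: (@below_step _ _ _ _ u); first by apply: pA; rewrite /= inE eqxx.
    by rewrite /up xu.
  by apply: IHp => // v /= vp; apply: pA; rewrite /= in_cons vp orbT.
elim=> [z Az|{}x u {}y Ax /andP[xu tu] _ [p [[pA pp pt] lp]]].
  by exists [::]; split=> //; split=> // v /=; rewrite inE => /eqP->.
exists (u :: p); rewrite /= lp; split=> //; split=> /=.
- by move=> v /=; rewrite in_cons => /predU1P[->//|vp]; apply: pA.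
- by rewrite xu.
- by rewrite tu.
Qed.

Lemma incidentE A x y : incident A x y <-> below A x y \/ below A y x.
Proof.
split=> [[p [h|h]]|[/dense_flag_below[p h]|/dense_flag_below[p h]]].
- by left; apply/dense_flag_below; exists p.
- by right; apply/dense_flag_below; exists p.
- by exists p; left.
- by exists p; right.
Qed.

Lemma residueE A a v : residue A a v <-> res A a v.
Proof. by rewrite /residue /= incidentE /res; tauto. Qed.

Lemma shadow0E A a v : shadow A 0 a v <-> below A v a /\ tp v = 0.
Proof.
split=> [[/residueE[va|av] /= v0]|[va v0]]; [by []| |by split=> //; apply/residueE; left].
split=> //; rewrite (below_eq av); last by rewrite v0.
exact/below_refl/(below_inr av).
Qed.

(** A common vertex of type 0 is a common lower bound, and the meet it provides has the common
    shadow. *)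
Lemma built_meets0 A : built A -> meets_closed A 0.
Proof.
move=> bA a a' Aa Aa' _.
have [[v [/shadow0E[va _] /shadow0E[va' _]]]|no] :=
  pselect (exists v, (shadow A 0 a `&` shadow A 0 a') v); last first.
  by right; apply/seteqP; split=> // v vv; case: no; exists v.
have [m [ma ma' mmax]] := built_glb bA va va'.
left; exists m; split; first exact: below_inl ma.
apply/seteqP; split=> [u [/shadow0E[ua u0] /shadow0E[ua' _]]|u /shadow0E[um u0]].
  by apply/shadow0E; split=> //; apply: mmax.
by split; apply/shadow0E; split=> //; apply: below_trans um _.
Qed.

Lemma connected_inP (P : set G) : connected (@edge n G) P -> connected_in P.
Proof.
move=> cP x y Px Py; have [l /walk_path[p [pp lp _ Pp]]] := cP x y Px Py.
by exists p; split.
Qed.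

(** Removing [a] from a cycle of length [k] leaves a walk of length [k - 2] from [b] to [b']
    avoiding [a]. *)
Lemma built_reduce_down A : built A -> cycles_reduce_down A.
Proof.
move=> bA a b b' s h c [_ /andP[cyc un] cA] tb tb' ha cT.
move: cyc; rewrite (cycle_path a) /c /= last_rcons => /and3P[b'a ab pb].
have nac : a \notin b :: rcons s b' by move: un => /andP[].
have Ac v : v \in c -> A v by move=> vc; exact: cA.
have [Aa Ab] : A a /\ A b by split; apply: Ac; rewrite /c !inE eqxx ?orbT.
have Ab' : A b' by apply: Ac; rewrite /c !in_cons mem_rcons mem_head !orbT.
have ba : below A b a by apply: up_below => //; rewrite /up edgeC ab -tb /=.
have b'a' : below A b' a by apply: up_below => //; rewrite /up b'a -tb' /=.
have w : walk (@edge n G) (out_walk A a h (fun v => v \in c)) (size s).+1 b b'.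
  apply/walk_path; exists (rcons s b'); rewrite last_rcons size_rcons; split=> // v vp.
  have vc : v \in c by rewrite /c in_cons vp orbT.
  split=> //; [exact: Ac|by move=> e; rewrite -e vp in nac|exact: cT].
have [l le_l /walk_path[p [pp lp sp Pp]]] := built_walks_reduce bA ba b'a' w.
exists p; split.
- split=> // v /Pp[va vT _]; split=> //=; apply/residueE; left; exact: va.
- by rewrite sp /c /= size_rcons; lia.
- by move=> v /Pp[_ _ vS] /(congr1 (@nat_of_ord _)); exact: vS.
Qed.

End Incidence.

Section Membership.
Variables (n : nat) (G : lgraph n).
Implicit Types (A : set G).
Local Open Scope classical_set_scope.

Lemma residue_dual A a : @residue n (dual G) A a = residue A a.
Proof.
apply/seteqP; split=> v.
  by move=> /residueE[]/below_dual h; apply/residueE; [right|left].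
by move=> /residueE[] h; apply/residueE; [right|left]; apply/below_dual.
Qed.

Lemma shadow_dual A a : @shadow n (dual G) A 0 a = shadow A n a.
Proof.
rewrite /shadow residue_dual; congr (_ `&` _); apply/seteqP.
split=> v /=; have := ltn_ord (@vtype n G v); lia.
Qed.

Lemma built_meetsn A : built A -> meets_closed A n.
Proof.
move=> /built_dual /built_meets0 md a a' Aa Aa' ne.
have := md a a' Aa Aa' ne; rewrite /meet_in_vertex /meet_in_empty !shadow_dual.
case=> [[z [Az zE]]|]; last by right.
by left; exists z; split=> //; rewrite zE shadow_dual.
Qed.

Lemma built_reduce_up A : built A -> cycles_reduce_up A.
Proof.
have tn v : @vtype n G v <= n by have := ltn_ord (@vtype n G v).
move=> /built_dual /built_reduce_down rd a b b' s h c cyc tb tb' ha cT.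
have hn := ltn_ord h.
have [|||v vc|p [pin sp ph]] := rd a b b' s (rev_ord h) cyc.
- by rewrite !dual_tp; have := tn b; lia.
- by rewrite !dual_tp; have := tn b'; lia.
- by rewrite !dual_tp /=; have := tn a; lia.
- by have := cT v vc; rewrite !dual_tp /=; have := tn a; lia.
exists p; split=> //.
  case: pin => pp lp pR; split=> // v /pR; rewrite residue_dual => -[va vT].
  by split=> //; move: vT => /=; have := tn v; have := tn a; lia.
by move=> v vp vh; apply: ph => //; rewrite /= vh.
Qed.

Lemma built_classK' A : built A -> classK' A.
Proof.
move=> bA; split.
- split; first exact: built_finite.
  split; [|exact: built_meets0|exact: built_meetsn|exact: built_reduce_down
          |exact: built_reduce_up].
  by move=> i c _; exact: built_no_Ecycle.
- by move=> i hi; apply: connected_inP; exact: built_connected.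
- move=> a i Aa hi; apply: connected_inP; have := built_res_connected bA Aa hi.
  move=> cn x y [/residueE xa xT] [/residueE ya yT].
  have [l w] := cn x y (conj xa xT) (conj ya yT); exists l.
  by apply: walk_mono w => v [va vT]; split=> //; apply/residueE.
Qed.

End Membership.

(** * Strong extensions *)

Section Strong.
Variables (n : nat) (G : lgraph n).
Local Notation tp x := (nat_of_ord (@vtype n G x)).
Implicit Types (A B : set G) (a b c u v x y z : G) (s : seq G).
Local Open Scope classical_set_scope.

Lemma below_up A x y : below A x y -> (tp x).+1 = tp y -> up x y.
Proof.
move=> /below_first[->|[u [xu uy]] t]; first by lia.
by rewrite -(below_eq uy) // (up_tp xu) t.
Qed.

Lemma uniq_map_inj (T1 T2 : eqType) (f : T1 -> T2) (r : seq T1) :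
  uniq (map f r) -> {in r &, injective f}.
Proof.
elim: r => //= a r IHr /andP[ar ur] x y; rewrite !inE.
case/predU1P=> [->|xr] /predU1P[->|yr] // fxy; last exact: IHr.
  by rewrite fxy map_f in ar.
by rewrite -fxy map_f in ar.
Qed.

Lemma maximal_flag_set A s : maximal_flag A s -> A = [set` s] -> flag_set A.
Proof.
move=> [[un sA inc] sT] AE.
have in_s x : A x -> x \in s by rewrite AE.
split=> [k le_k|x y Ax Ay e|x y Ax Ay e].
- have : k \in [seq (vtype x : nat) | x <- s] by rewrite sT mem_iota; lia.
  by case/mapP=> x xs ->; exists x; split=> //; apply: sA.
- have := iota_uniq 0 n.+1; rewrite -sT => /uniq_map_inj; apply=> //; exact: in_s.
- have [/below_up xy|/below_tp] := (incidentE _ _ _).1 (inc x y (in_s _ Ax) (in_s _ Ay)).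
    by apply: up_edge; apply: xy.
  by lia.
Qed.

(** For a middle extension the original is the middle vertex of the dense flag. For an end extension
    it is a vertex of the type of [y'] adjacent to the only neighbour of [y']. *)
Lemma elementary_clone A B : 0 < n -> built A -> elementary_strong A B ->
  exists y y', clone A y y' /\ B = y' |` A.
Proof.
move=> n0 bA [_ [y' [nA -> ext]]].
case: ext => [[ty un con]|[x [y [z [[sA /= /and3P[xy yz _] /and3P[/eqP txy /eqP tyz _]] ty nb]]]]]; last first.
  have Ax : A x by apply: sA; rewrite /= !inE eqxx.
  have Ay : A y by apply: sA; rewrite /= !inE eqxx orbT.
  have Az : A z by apply: sA; rewrite /= !inE eqxx !orbT.
  exists y, y'; split=> //; split=> //.
    by move=> u Au /nb[] // ->; rewrite // edgeC.
  have ty' : tp y' = tp y by rewrite ty.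
  split=> [u v Au Av /nb[] // -> /nb[] // ->|k le_k kE]; [by lia|by lia|].
  case: kE => kE; [exists x|exists z]; split=> //; [by apply/nb; auto|lia|by apply/nb; auto|lia].
(* connectedness yields exactly one neighbour w of an end vertex y' *)
have other k i : k <= n -> 0 < i <= n -> tp y' <> k ->
    (tp y' = i.-1 \/ tp y' = i) -> (k = i.-1 \/ k = i) -> exists w, A w /\ edge y' w.
  move=> le_k hi ne yi ki; have [v [Av vE]] := built_types bA le_k.
  have [||[|w p] [pp lp pB]] := con i hi y' v.
  - by split=> //; left.
  - by split; [right|rewrite vE].
  - by case: ne; rewrite -vE -lp.
  exists w; move: pp => /= /andP[yw _]; split=> //.
  have [[e|//] _] : (y' |` A) w /\ (tp w = i.-1 \/ tp w = i).
    by apply: pB; rewrite /= !inE eqxx orbT.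
  by move: (edge_tp yw); rewrite e; lia.
have [w [Aw yw]] : exists w, A w /\ edge y' w.
  case: ty => t0; first by apply: (other 1 1); rewrite ?t0 //; lia.
  by apply: (other n.-1 n); rewrite ?t0; lia.
have tw := edge_tp yw.
have [y [Ay wy ty']] : exists y, [/\ A y, edge w y & tp y = tp y'].
  by apply: built_nbr => //; have := ltn_ord (vtype y'); lia.
exists y, y'; split=> //; split=> //.
- by apply/val_inj; rewrite /= ty'.
- by move=> u Au yu; rewrite edgeC -(un w u).
split=> [u v Au Av yu yv _|k le_k kE]; first exact: un.
exists w; split=> //; have := ltn_ord (vtype w); lia.
Qed.

Lemma strong_built A B : 0 < n -> strong A B -> built A -> built B /\ A `<=` B.
Proof.
move=> n0; elim=> {A B} [A B AB bA|A bA|A B C _ IH1 _ IH2 bA].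
- have [y [y' [cl ->]]] := elementary_clone n0 bA AB.
  by split; [exact: built_clone cl|move=> v; right].
- by split.
have [bB sAB] := IH1 bA; have [bC sBC] := IH2 bB.
by split=> // v /sAB/sBC.
Qed.

(** Converse of [elementary_clone]; the connectedness required of the extension holds because it is
    again built. *)
Lemma clone_elementary A y y' : 0 < n -> built A -> clone A y y' ->
  elementary_strong A (y' |` A).
Proof.
move=> n0 bA cl; have [_ conA _] := built_classK' bA.
have [_ conB _] := built_classK' (built_clone bA cl).
split.
  split=> //; first exact: built_finite.
    by exists y; case: cl.
  by move=> i hi; apply: built_types => //; lia.
exists y'; split=> //; first by case: cl.
have lt := ltn_ord (vtype y').
have [t0|t0] := posnP (tp y').
  left; split=> //; first by left.
  move=> u v Au Av yu yv; apply: (clone_uniq cl Au Av yu yv).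
  by have := edge_tp yu; have := edge_tp yv; lia.
have [tn|tn] := eqVneq (tp y') n.
  left; split=> //; first by right.
  move=> u v Au Av yu yv; apply: (clone_uniq cl Au Av yu yv).
  have := ltn_ord (vtype u); have := ltn_ord (vtype v).
  by have := edge_tp yu; have := edge_tp yv; lia.
right; have [x [Ax xy]] := clone_lower cl t0.
have [|z [Az yz]] := clone_upper cl; first by lia.
have xy0 := up_lower cl Ax xy; have yz0 := up_upper cl Az yz.
exists x, y, z; split; last 1 first.
- move=> u Au; split=> [yu|[->|->]]; last exact: up_edge.
    case: (edge_up yu) => h; [right|left].
      exact: (upper_uniq cl Au Az h yz).
    exact: (lower_uniq cl Au Ax h xy).
  by rewrite edgeC; exact: up_edge.
- split.
  + by move=> v /=; rewrite !inE => /or3P[]/eqP->//; case: cl.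
  + by rewrite /= (up_edge xy0) (up_edge yz0).
  + by move: xy0 yz0 => /andP[_ xy1] /andP[_ yz1]; rewrite /= xy1 yz1.
- by case: cl.
Qed.

End Strong.

(** * Images under embeddings *)

Section Transport.
Variables (n : nat) (G H : lgraph n) (f : G -> H).
Implicit Types (A : set G).
Local Open Scope classical_set_scope.

Lemma embedding_sub A B : A `<=` B -> embedding_on B f -> embedding_on A f.
Proof.
move=> AB [i t e]; have AB' x : x \in A -> x \in B by rewrite !inE => /AB.
split=> [x y /AB' xB /AB' yB|x /AB' xB|x y /AB' xB /AB' yB].
- exact: i.
- exact: t.
- exact: e.
Qed.

(** The extension property speaks of abstract graphs, so the construction by clones has to be
    carried along an embedding. *)
Lemma built_image A : built A -> embedding_on A f -> built (f @` A).
Proof.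
elim=> {A} [A [inh inj ed] [fi ft fe]|A y y' bA IH cl fB].
  apply: built_flag; split=> [k /inh[x [Ax xE]]|_ _ [x Ax <-] [y Ay <-]|_ _ [x Ax <-] [y Ay <-]].
  - by exists (f x); split; [exists x|rewrite (ft x (mem_set Ax))].
  - by rewrite (ft x (mem_set Ax)) (ft y (mem_set Ay)) => /(inj x y Ax Ay)->.
  - rewrite (ft x (mem_set Ax)) (ft y (mem_set Ay)) (fe _ _ (mem_set Ax) (mem_set Ay)).
    exact: ed.
rewrite image_setU image_set1.
have [fi ft fe] := fB.
have inB v : A v -> v \in y' |` A by rewrite inE; right.
have y'B : y' \in y' |` A by rewrite inE; left.
have [Ay nA ty sub [un ex]] := cl.
apply: built_clone (f y) _ _ _; first by apply: IH; apply: embedding_sub fB; right.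
split.
- by exists y.
- by case=> x Ax /fi e; apply: nA; rewrite -(e (inB _ Ax) y'B).
- by rewrite (ft _ y'B) (ft _ (inB _ Ay)).
- move=> _ [u Au <-]; rewrite (fe _ _ y'B (inB _ Au)) (fe _ _ (inB _ Ay) (inB _ Au)).
  exact: sub.
split=> [_ _ [u Au <-] [v Av <-]|k le_k].
  rewrite (fe _ _ y'B (inB _ Au)) (fe _ _ y'B (inB _ Av)) (ft _ (inB _ Au)) (ft _ (inB _ Av)).
  by move=> yu yv e; congr f; apply: un.
rewrite (ft _ y'B) => kE; have [u [Au yu uE]] := ex k le_k kE.
exists (f u); rewrite (fe _ _ y'B (inB _ Au)) (ft _ (inB _ Au)).
by split=> //; exists u.
Qed.

End Transport.

(** * The abstract graph with one vertex adjoined *)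

Section OnePoint.
Variables (n : nat) (G : lgraph n) (A : set G) (y : G) (nb : pred G).
Hypotheses (nby : forall u, A u -> nb u -> edge y u).
Local Open Scope classical_set_scope.
Local Notation V := (option {x : G | x \in A}).

(** [None] is the adjoined vertex, of the type of [y]. *)
Definition point_vtype (v : V) := if v is Some x then vtype (val x) else vtype y.

Definition point_edge (u v : V) := match u, v with
  | Some a, Some b => edge (val a) (val b)
  | Some a, None | None, Some a => nb (val a)
  | None, None => false
  end.

Lemma point_edgeC : symmetric point_edge.
Proof. by case=> [a|] [b|] //=; rewrite edgeC. Qed.

Lemma point_edge_vtype u v : point_edge u v ->
  (point_vtype u).+1 = point_vtype v :> nat \/ (point_vtype v).+1 = point_vtype u :> nat.
Proof.
have yb (b : {x : G | x \in A}) : nb (val b) -> edge y (val b).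
  by apply: nby; exact: set_mem (valP b).
case: u v => [a|] [b|] //=; [exact: edge_vtype|move=> /yb|move=> /yb/edge_vtype//].
by rewrite edgeC => /edge_vtype.
Qed.

Definition point_graph : lgraph n := LGraph point_edgeC point_edge_vtype.

(** [insub] gives the default [None] outside [A]; the map is an embedding on [A]. *)
Definition to_point (x : G) : point_graph := insub x : V.

Lemma to_pointE x (Ax : A x) : to_point x = Some (exist _ x (mem_set Ax)).
Proof. by rewrite /to_point (insubT (fun x => x \in A) (mem_set Ax)). Qed.

Lemma to_point_embedding : embedding_on A to_point.
Proof.
split=> [x x' | x |x x']; rewrite !inE.
- by move=> Ax Ax'; rewrite !to_pointE => -[].
- by move=> Ax; rewrite to_pointE.
- by move=> Ax Ax'; rewrite !to_pointE.
Qed.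

Lemma point_setT : [set: point_graph] = (None : point_graph) |` (to_point @` A).
Proof.
apply/seteqP; split=> // -[[x xA] _|]; [right|by left].
by exists x; [exact: set_mem|rewrite to_pointE; [exact: set_mem|move=> Ax; congr Some; exact: val_inj]].
Qed.

Lemma point_edge_new x : A x -> edge (None : point_graph) (to_point x) = nb x.
Proof. by move=> Ax; rewrite to_pointE. Qed.

End OnePoint.

(** * Distances between flags *)

Section LongerMultiple.
Variable n : nat.
Local Notation s := (@cox_gen n).
Local Notation "''w' u" := (word_prod s u) (at level 8, u at level 8).
Implicit Types (i j k : 'I_n.+1) (u v r : seq 'I_n.+1) (w : cox n).
Local Open Scope group_scope.

Definition longer_lmul i w := if ldescent w i then w else s i * w.
Definition longer_rmul i w := if rdescent w i then w else w * s i.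

(* The possible changes of the distance w from a fixed chamber along a panel of
   type i: the panel has at most one chamber at the smaller of the distances w, w s_i. *)
Definition panel_step i w w' := w' = w * s i \/ (w' = w /\ rdescent w i).

Lemma longer_rmulV i w : longer_rmul i w^-1 = (longer_lmul i w)^-1.
Proof. by rewrite /longer_rmul /longer_lmul /rdescent invgK -/(ldescent w i); case: ifP => //; rewrite invgM gen_inv. Qed.

Lemma rdescent_mul i w : rdescent (w * s i) i = ~~ rdescent w i.
Proof. by rewrite /rdescent invgM gen_inv cross_smul. Qed.

Lemma rdescent_mul_far i k w : far i k -> rdescent (w * s k) i = rdescent w i.
Proof. by move=> ik; rewrite /rdescent invgM gen_inv cross_mul_far. Qed.

Lemma mul_genK i w : w * s i * s i = w.
Proof. by rewrite -mulgA gen_sq mulg1. Qed.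

Lemma panel_step_sym i w w' : panel_step i w w' -> panel_step i w' w.
Proof. by case=> [->|[-> ?]]; [left; rewrite mul_genK|right]. Qed.

(** By exchange there are two cases. If [s j * w] differs from [w * s i], right multiplication by
    [s i] keeps the status of the left descent [j], and both operations commute. If they agree, [w]
    and [w * s i] lengthen to the same element, which has right descent [i]. *)
Lemma longer_lmul_step i j w w' : panel_step i w w' -> panel_step i (longer_lmul j w) (longer_lmul j w').
Proof.
have excl : rdescent w i -> ldescent w j = false -> rdescent (s j * w) i.
  move=> dr dl; rewrite /rdescent invgM gen_inv cross_mulr -/(rdescent w i) dr.
  case: eqP => // e; have e' : s j * w = w * s i.
    by rewrite -[LHS]invgK invgM gen_inv -e invgM gen_inv invgK.
  by rewrite (ldescent_rdescent e') dr in dl.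
case=> [->|[-> dr]]; last by rewrite /longer_lmul; case dl: (ldescent w j); right; rewrite ?excl.
have -> : longer_lmul j (w * s i) =
    if ldescent w j (+) (s j * w == w * s i) then w * s i else s j * (w * s i).
  by rewrite /longer_lmul {1}/ldescent cross_mulr.
rewrite /longer_lmul.
have [e|_] := eqVneq (s j * w) (w * s i); last first.
  by rewrite addbF; case: (ldescent w j); left; rewrite ?mulgA.
rewrite addbT; have := ldescent_rdescent e; case dl: (ldescent w j) => /= dr; right; split=> //.
- by rewrite mulgA e mul_genK.
- by rewrite e rdescent_mul -dr.
Qed.

Lemma longer_rmul_step_far i j w w' : far i j -> panel_step i w w' ->
  panel_step i (longer_rmul j w) (longer_rmul j w').
Proof.
move=> ij; have ji : far j i by rewrite farC.
case=> [->|[-> dr]]; last first.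
  by right; split=> //; rewrite /longer_rmul; case: ifP; rewrite ?rdescent_mul_far.
left; rewrite /longer_rmul rdescent_mul_far //; case: ifP => // _.
by rewrite -!mulgA (far_comm ij).
Qed.

(** Here [w'] is [w] or [w * s i], and lengthening either gives the longer of the two. *)
Lemma longer_rmul_step_same i w w' : w' = w \/ panel_step i w w' ->
  panel_step i w (longer_rmul i w').
Proof.
have self : panel_step i w (longer_rmul i w).
  by rewrite /longer_rmul; case: ifP => dr; [right|left].
case=> [->//|[->|[-> _]//]].
rewrite {1}/longer_rmul rdescent_mul; case dr: (rdescent w i) => /=; last by left.
by right; rewrite mul_genK.
Qed.

(** [s i] commutes with the product of [u], and [i] is a descent of it on neither side. *)
Lemma longer_lmul_far_word i u w' : all (far i) u -> w' = 'w u \/ panel_step i ('w u) w' ->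
  longer_lmul i w' = 'w u * s i.
Proof.
move=> fu; have c := word_far_comm fu.
have dl : ldescent ('w u) i = false by rewrite /ldescent cross_word crossw_far.
have dr : rdescent ('w u) i = false by rewrite -(ldescent_rdescent c).
case=> [->|[->|[-> ]]]; last by rewrite dr.
- by rewrite /longer_lmul dl c.
- by rewrite /longer_lmul -c {1}/ldescent cross_smul -/(ldescent ('w u) i) dl.
Qed.

Lemma longer_lmul_neq1 i w : longer_lmul i w <> 1.
Proof.
rewrite /longer_lmul; case: ifP => [dl e|dl e]; first by rewrite e /ldescent cross1 in dl.
by have := cross_smul i w; rewrite e cross1 -/(ldescent w i) dl.
Qed.

Lemma longer_rmul_neq1 i w : longer_rmul i w <> 1.
Proof.
rewrite -[w]invgK longer_rmulV => e.
by apply: (@longer_lmul_neq1 i w^-1); rewrite -[LHS]invgK e invg1.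
Qed.

End LongerMultiple.

(** * The distance along clones *)

Section WeakDistance.
Variables (n : nat) (G : lgraph n).
Local Notation W := (cox n).
Local Notation s := (@cox_gen n).
Local Notation "''w' u" := (word_prod s u) (at level 8, u at level 8).
Local Notation clone_set A y := (y |` A)%classic.
Implicit Types (A B : set G) (x y z : G) (c d e : n.+1.-tuple G) (i j k : 'I_n.+1).
Implicit Types (u p q r : seq 'I_n.+1).
Local Open Scope group_scope.

Definition chamber_in A c := [/\ forall i, A (tnth c i), forall i, vtype (tnth c i) = i
  & forall i j, i.+1 = j :> nat -> edge (tnth c i) (tnth c j)].

Definition differ_at i c d :=
  tnth c i <> tnth d i /\ forall j, j != i -> tnth c j = tnth d j.

Lemma differ_at_sym i c d : differ_at i c d -> differ_at i d c.
Proof. by case=> ne eq; split=> [/esym//|j /eq]. Qed.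

Lemma differ_at_agree i c d : (forall j, j != i -> tnth c j = tnth d j) -> c = d \/ differ_at i c d.
Proof.
move=> eq; have [e|/eqP ne] := eqVneq (tnth c i) (tnth d i); last by right.
by left; apply: eq_from_tnth => j; have [->//|/eq] := eqVneq j i.
Qed.

(* Panels may be singletons: the axiom of buildings providing chambers at distance
   w s_i is missing. *)
Definition weak_distance A (delta : n.+1.-tuple G -> n.+1.-tuple G -> W) :=
  [/\ forall c d, chamber_in A c -> chamber_in A d -> delta c d = 1 -> c = d,
      forall c d, chamber_in A c -> chamber_in A d -> delta d c = (delta c d)^-1,
      forall c d e i, chamber_in A c -> chamber_in A d -> chamber_in A e -> differ_at i d e ->
        panel_step i (delta c d) (delta c e)
    & forall c d, chamber_in A c -> chamber_in A d -> exists u, 'w u = delta c d /\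
        forall i, i \in u -> tnth c i <> tnth d i].

Lemma chamber_up A c i j : chamber_in A c -> i.+1 = j :> nat -> up (tnth c i) (tnth c j).
Proof. by case=> _ ty ed ij; rewrite /up !ty ij eqxx ed. Qed.

Section Step.
Variables (A : set G) (y y' : G) (cl : clone A y y').
Local Notation B := (clone_set A y').
Local Notation t := (vtype y').

Definition fold_chamber c := [tuple fold_clone y y' (tnth c j) | j < n.+1].
Definition isnew c := tnth c t == y'.

Lemma fold_chamberE c j : tnth (fold_chamber c) j = fold_clone y y' (tnth c j).
Proof. by rewrite tnth_mktuple. Qed.

Lemma chamber_fold c : chamber_in B c -> chamber_in A (fold_chamber c).
Proof.
move=> hc; have [inB ty ed] := hc; split=> [i|i|i j ij]; rewrite !fold_chamberE.
- exact: fold_in.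
- by rewrite /fold_clone; case: eqP => // e; rewrite -(ty i) e; case: cl.
- by apply/up_edge/(fold_up cl) => //; exact: chamber_up hc ij.
Qed.

Lemma new_index c j : chamber_in B c -> tnth c j = y' -> j = t.
Proof. by case=> _ ty _ e; rewrite -(ty j) e. Qed.

Lemma fold_other c j : chamber_in B c -> j != t -> tnth (fold_chamber c) j = tnth c j.
Proof.
move=> hc jt; rewrite fold_chamberE /fold_clone; case: eqP => // /(new_index hc) e.
by rewrite e eqxx in jt.
Qed.

Lemma fold_chamber_old c : chamber_in B c -> ~~ isnew c -> fold_chamber c = c.
Proof.
move=> hc nc; apply: eq_from_tnth => j; rewrite fold_chamberE /fold_clone.
by case: eqP => // e; move: nc; rewrite /isnew -(new_index hc e) e eqxx.
Qed.

Lemma fold_chamber_neq c d j : tnth (fold_chamber c) j <> tnth (fold_chamber d) j ->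
  tnth c j <> tnth d j.
Proof. by move=> ne e; apply: ne; rewrite !fold_chamberE e. Qed.

(** At the types next to that of [y'], both chambers contain the unique neighbour of [y']. *)
Lemma new_agree c d j : chamber_in B c -> chamber_in B d -> isnew c -> isnew d -> ~~ far j t ->
  tnth c j = tnth d j.
Proof.
move=> hc hd nc nd nfar; have [->|ne] := eqVneq j t; first by rewrite (eqP nc) (eqP nd).
have inA e : chamber_in B e -> A (tnth e j).
  move=> he; have [inB _ _] := he; case: (clone_in (inB j)) => // /(new_index he) ej.
  by rewrite ej eqxx in ne.
have [tj|jt] := not_far ne nfar.
  have := chamber_up hc (esym tj); have := chamber_up hd (esym tj).
  rewrite (eqP nc) (eqP nd) => ud uc; exact: (lower_uniq cl (inA _ hc) (inA _ hd) uc ud).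
have := chamber_up hc (esym jt); have := chamber_up hd (esym jt).
rewrite (eqP nc) (eqP nd) => ud uc; exact: (upper_uniq cl (inA _ hc) (inA _ hd) uc ud).
Qed.

Lemma differ_at_old c d i : chamber_in B c -> chamber_in B d -> ~~ isnew c -> ~~ isnew d -> differ_at i c d ->
  differ_at i (fold_chamber c) (fold_chamber d).
Proof. by move=> hc hd nc nd; rewrite !fold_chamber_old. Qed.

Lemma differ_at_new c d i : chamber_in B c -> chamber_in B d -> isnew c -> isnew d -> differ_at i c d ->
  far i t /\ differ_at i (fold_chamber c) (fold_chamber d).
Proof.
move=> hc hd nc nd [ne eq]; split.
  by apply/negPn/negP => /(new_agree hc hd nc nd).
have it : i != t by apply/eqP => e; subst i; apply: ne; rewrite (eqP nc) (eqP nd).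
split=> [|j ji]; first by rewrite !fold_other.
by rewrite !fold_chamberE eq.
Qed.

Lemma differ_at_mixed c d i : ~~ isnew c -> isnew d -> differ_at i c d ->
  i = t /\ (fold_chamber c = fold_chamber d \/ differ_at i (fold_chamber c) (fold_chamber d)).
Proof.
move=> nc nd [ne eq]; have it : i = t.
  have [//|it] := eqVneq i t; move: nc; rewrite /isnew eq; last by rewrite eq_sym.
  by move: nd; rewrite /isnew => ->.
by split=> //; apply: differ_at_agree => j ji; rewrite !fold_chamberE eq.
Qed.

Variable delta : n.+1.-tuple G -> n.+1.-tuple G -> W.
Hypothesis wd : weak_distance A delta.

(** A chamber through [y'] never gets the shorter of the two distances possible in its panel, since
    that place can be taken only once. *)
Definition clone_distance c d :=
  let w := delta (fold_chamber c) (fold_chamber d) in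
  if isnew c == isnew d then w else if isnew c then longer_lmul t w else longer_rmul t w.

(** The panel clause is the essential one, split by which of [c], [d], [e] contain [y']. If only [c]
    does, it is [longer_lmul_step]; if [c] does not, lengthening acts on the side of the panel; if
    all or none do, it is the clause for the folded chambers. *)
Lemma clone_weak_distance : weak_distance B clone_distance.
Proof.
have [d0 d1 d2 d3] := wd; split.
- move=> c d hc hd; have [fc fd] := (chamber_fold hc, chamber_fold hd); rewrite /clone_distance.
  case nc: (isnew c); case nd: (isnew d) => /=.
  + move=> /(d0 _ _ fc fd) e; apply: eq_from_tnth => j.
    have [->|jt] := eqVneq j t; first by rewrite (eqP nc) (eqP nd).
    by rewrite -(fold_other hc jt) e fold_other.
  + by move/longer_lmul_neq1.
  + by move/longer_rmul_neq1.
  + by move=> /(d0 _ _ fc fd); rewrite !fold_chamber_old ?nc ?nd.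
- move=> c d hc hd; have [fc fd] := (chamber_fold hc, chamber_fold hd); rewrite /clone_distance.
  rewrite (d1 _ _ fc fd); case nc: (isnew c); case nd: (isnew d) => //=.
  + exact: longer_rmulV.
  + by rewrite -[delta (fold_chamber c) _ in RHS]invgK longer_rmulV invgK.
- move=> c d e i hc.
  have fc := chamber_fold hc.
  (* [panel_step] is symmetric, so the case where only [d] of the two contains [y'] reduces to the
     one where only [e] does. *)
  wlog : d e / isnew d -> isnew e => [H|de hd he dif_de].
    move=> hd he dif_de; case nd: (isnew d); last by apply: H; rewrite ?nd.
    by apply: panel_step_sym; apply: H => //; exact: differ_at_sym.
  have [fd fe] := (chamber_fold hd, chamber_fold he); rewrite /clone_distance.
  case nc: (isnew c); case nd: (isnew d) de; case ne: (isnew e) => /= de;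
    try by have := de isT.
  + have [_ fdif] := differ_at_new hd he nd ne dif_de; exact: d2.
  + have [it fdif] := differ_at_mixed (negbT nd) ne dif_de.
    (* [c] and [e] both contain [y'], so they agree at its type and next to it; their folded
       distance is a word in letters far from this type. *)
    have [u [uE un]] := d3 _ _ fc fe.
    have fu : all (far t) u.
      apply/allP => j /un /fold_chamber_neq ne_j; apply/negPn/negP; rewrite farC => nfar.
      exact/ne_j/(new_agree hc he nc ne nfar).
    rewrite it in fdif *; apply: panel_step_sym; rewrite (longer_lmul_far_word fu); first by rewrite -uE; left.
    by case: fdif => [->|fdif]; [left|right; apply: panel_step_sym; rewrite uE; apply: d2].
  + by apply: longer_lmul_step; apply: d2 => //; apply: differ_at_old; rewrite ?nd ?ne.
  + have [fi fdif] := differ_at_new hd he nd ne dif_de.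
    by apply: longer_rmul_step_far => //; apply: d2.
  + have [it fdif] := differ_at_mixed (negbT nd) ne dif_de.
    rewrite -it; apply: longer_rmul_step_same; case: fdif => [->|fdif]; [by left|right].
    exact: d2.
  + by apply: d2 => //; apply: differ_at_old; rewrite ?nd ?ne.
- move=> c d hc hd; have [u [uE ud]] := d3 _ _ (chamber_fold hc) (chamber_fold hd).
  have ud' i : i \in u -> tnth c i <> tnth d i by move=> /ud; exact: fold_chamber_neq.
  have base w : w = 'w u \/ isnew c != isnew d /\ (w = s t * 'w u \/ w = 'w u * s t) ->
      exists v, 'w v = w /\ forall i, i \in v -> tnth c i <> tnth d i.
    case=> [->|[ne [->|->]]]; first by exists u.
    + exists (t :: u); rewrite wcons; split=> // i; rewrite in_cons => /orP[/eqP->|/ud'//].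
      by move=> e; move: ne; rewrite /isnew e eqxx.
    + exists (rcons u t); rewrite -cats1 wcat wseq1; split=> // i.
      rewrite mem_cat inE => /orP[/ud'//|/eqP->].
      by move=> e; move: ne; rewrite /isnew e eqxx.
  apply: base; rewrite /clone_distance -uE /longer_lmul /longer_rmul.
  by case: (isnew c) (isnew d) => -[] /=; rewrite ?eqxx; first [by left|case: ifP => _; auto].
Qed.

End Step.

Lemma built_weak_distance A : built A -> exists delta, weak_distance A delta.
Proof.
elim=> {A} [A [_ inj _]|A y y' _ [delta wd] cl]; last first.
  by exists (clone_distance y y' delta); exact: clone_weak_distance.
have same c d : chamber_in A c -> chamber_in A d -> c = d.
  move=> [Ac tc _] [Ad td _]; apply: eq_from_tnth => j.
  by apply: inj; rewrite ?tc ?td.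
exists (fun _ _ => 1); split.
- by move=> c d hc hd _; exact: same.
- by move=> c d _ _; rewrite invg1.
- by move=> c d e i _ hd he [[]]; rewrite (same _ _ hd he).
- by move=> c d _ _; exists [::]; rewrite wnil.
Qed.

(** * Galleries and their types *)

Fixpoint gallery_in A r c d : Prop :=
  if r is i :: r' then exists e, [/\ chamber_in A e, differ_at i c e & gallery_in A r' e d] else c = d.

Lemma gallery_cat A r r' c d e : gallery_in A r c d -> gallery_in A r' d e -> gallery_in A (r ++ r') c e.
Proof.
elim: r c => [|i r IHr] c /=; first by move=> ->.
by move=> [f [hf cf fd]] de; exists f; split=> //; exact: IHr.
Qed.

Lemma chamber_mono A B c : (forall v, A v -> B v) -> chamber_in A c -> chamber_in B c.
Proof. by move=> AB [inA ty ed]; split=> // i; apply: AB. Qed.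

Lemma gallery_mono A B r c d : (forall v, A v -> B v) -> gallery_in A r c d -> gallery_in B r c d.
Proof.
move=> AB; elim: r c => //= i r IHr c [e [he ce ed]]; exists e.
by split=> //; [exact: chamber_mono he|exact: IHr].
Qed.

Lemma gallery_end A r c d : chamber_in A c -> gallery_in A r c d -> chamber_in A d.
Proof. by elim: r c => [|i r IHr] c hc /= => [<-|[e [he _ /(IHr _ he)]]]. Qed.

(** Distances are measured from the far end [d]. Prefixing [i] to form a reduced word is an ascent,
    which excludes the stationary alternative of [panel_step]. *)
Lemma gallery_distance A delta r c d : weak_distance A delta -> chamber_in A c ->
  reduced s r -> gallery_in A r c d -> delta c d = 'w r.
Proof.
move=> [_ d1 d2 d3]; elim: r c => [|i r IHr] c hc red.
  (* The support clause leaves no letter for a word from [c] to itself. *)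
  move=> /= <-; have [u [<- uc]] := d3 c c hc hc; case: u uc => // j u.
  by move=> /(_ j (mem_head _ _)).
move=> [e [he ce ed]]; have hd := gallery_end he ed.
have ih := IHr _ he (reduced_cons red) ed.
rewrite (d1 _ _ hd hc) wcons.
case: (d2 d e c i hd he hc (differ_at_sym ce)) => [->|[_]].
  by rewrite invgM gen_inv -(d1 _ _ hd he) ih.
by rewrite (d1 _ _ he hd) ih /rdescent invgK -/(ldescent ('w r) i) (reduced_cons_ldescent red).
Qed.

Lemma gallery_word_unique A r r' c d : built A -> chamber_in A c -> reduced s r -> reduced s r' ->
  gallery_in A r c d -> gallery_in A r' c d -> 'w r = 'w r'.
Proof.
move=> /built_weak_distance[delta wd] hc red red' g g'.
by rewrite -(gallery_distance wd hc red g) (gallery_distance wd hc red' g').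
Qed.

Lemma gallery_connected A c d : built A -> chamber_in A c -> chamber_in A d -> exists r, gallery_in A r c d.
Proof.
move=> bA; elim: bA c d => {A} [A [_ inj _]|A y y' _ IH cl] c d hc hd.
  exists [::]; move: hc hd => [Ac tc _] [Ad td _]; apply: eq_from_tnth => j.
  by apply: inj; rewrite ?tc ?td.
have fold_adj c0 : chamber_in (clone_set A y') c0 ->
    c0 = fold_chamber y y' c0 \/ differ_at (vtype y') c0 (fold_chamber y y' c0).
  by move=> hc0; apply: differ_at_agree => j jt; rewrite (fold_other _ hc0 jt).
have sub e : chamber_in A e -> chamber_in (clone_set A y') e by apply: chamber_mono => v; right.
have [r g] := IH _ _ (chamber_fold cl hc) (chamber_fold cl hd).
have {}g : gallery_in (clone_set A y') r (fold_chamber y y' c) (fold_chamber y y' d).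
  by apply: gallery_mono g => v; right.
have [r1 g1] : exists r1, gallery_in (clone_set A y') r1 c (fold_chamber y y' c).
  case: (fold_adj c hc) => [e|df]; first by exists [::].
  by exists [:: vtype y'], (fold_chamber y y' c); split=> //; apply/sub/(chamber_fold cl).
have [r2 g2] : exists r2, gallery_in (clone_set A y') r2 (fold_chamber y y' d) d.
  case: (fold_adj d hd) => [e|df]; first by exists [::].
  by exists [:: vtype y'], d; split=> //; apply: differ_at_sym.
by exists (r1 ++ (r ++ r2)); apply: gallery_cat g1 (gallery_cat g g2).
Qed.

Definition set_vertex c i y : n.+1.-tuple G :=
  [tuple if j == i then y else tnth c j | j < n.+1].

Lemma set_vertex_same c i y : tnth (set_vertex c i y) i = y.
Proof. by rewrite tnth_mktuple eqxx. Qed.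

Lemma set_vertex_other c i y j : j != i -> tnth (set_vertex c i y) j = tnth c j.
Proof. by rewrite tnth_mktuple => /negbTE ->. Qed.

Lemma set_vertex_chamber A c i y : chamber_in A c -> A y -> vtype y = i ->
  (forall j, i.+1 = j :> nat \/ j.+1 = i :> nat -> edge y (tnth c j)) ->
  chamber_in A (set_vertex c i y).
Proof.
move=> [inA ty ed] Ay yi ye; split=> [j|j|j k jk]; rewrite !tnth_mktuple.
- by case: eqP.
- by case: eqP => // ->.
have [ej|nj] := eqVneq j i; have [ek|nk] := eqVneq k i.
- by subst j k; move: jk; lia.
- by apply: ye; left; rewrite -ej.
- by rewrite edgeC; apply: ye; right; rewrite -ek.
- exact: ed.
Qed.

(** The new middle chamber is [c] with its vertex of type [k] taken from [d]; types next to [k] are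
    unaffected by the change at [i]. *)
Lemma gallery_far_swap A i k c e d : chamber_in A c -> chamber_in A e -> chamber_in A d -> far i k ->
  differ_at i c e -> differ_at k e d -> exists f, [/\ chamber_in A f, differ_at k c f & differ_at i f d].
Proof.
move=> hc he hd ik [ne_i eq_i] [ne_k eq_k].
have neq_ik := far_neq ik; have neq_ki : k != i by rewrite eq_sym.
have [inAd tyd edd] := hd.
exists (set_vertex c k (tnth d k)); split.
- apply: set_vertex_chamber => // j jk.
  have ji : j != i by apply: contraTneq ik => e1; subst j; rewrite /far; lia.
  have jk' : j != k by apply/eqP => e1; subst j; lia.
  rewrite eq_i // eq_k //; case: jk => jk; first exact: edd.
  by rewrite edgeC; exact: edd.
- split=> [|j jk]; last by rewrite set_vertex_other.
  by rewrite set_vertex_same eq_i.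
split=> [|j ji].
  by rewrite set_vertex_other // -eq_k.
have [->|jk] := eqVneq j k; first by rewrite set_vertex_same.
by rewrite set_vertex_other // eq_i // eq_k.
Qed.

Lemma gallery_far_front A i p q c d : chamber_in A c -> all (far i) p ->
  gallery_in A (p ++ i :: q) c d -> gallery_in A (i :: p ++ q) c d.
Proof.
elim: p c => // k p IHp c hc /= /andP[ik ip] [e [he ce]].
move=> /(IHp _ he ip) /= [f [hf ef fd]].
have [g [hg cg gf]] := gallery_far_swap hc he hf (etrans (farC k i) ik) ce ef.
by exists g; split=> //; exists f.
Qed.

Lemma word_far_front i p q : all (far i) p -> 'w (p ++ i :: q) = 'w (i :: p ++ q).
Proof. by move=> ip; rewrite wcat !wcons wcat mulgA -word_far_comm // mulgA. Qed.

Lemma reduced_eq r r' : 'w r = 'w r' -> size r = size r' -> reduced s r -> reduced s r'.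
Proof. by move=> e sz red r1 e1; rewrite -sz; apply: red; rewrite e1. Qed.

(** If prefixing [i] destroys reducedness, the next [i] can be moved to the front of the remaining
    gallery. Its two chambers and [c] lie in one panel, so the two steps of type [i] merge into one
    or vanish. *)
Lemma gallery_reduced A r c d : chamber_in A c -> gallery_in A r c d ->
  exists2 r', reduced s r' & gallery_in A r' c d.
Proof.
elim: r c => [|i r IHr] c hc /=.
  by move=> <-; exists [::] => // r'.
move=> [e [he ce /(IHr _ he)[q redq ed]]].
case desc_i: (ldescent ('w q) i); last first.
  by exists (i :: q); [exact: not_ldescent_reduced|exists e].
have [p1 [p2 [qE far1]]] := reduced_descent redq desc_i; subst q.
have redi : reduced s (i :: p1 ++ p2).
  by apply: reduced_eq redq; [exact: word_far_front|rewrite /= !size_cat addnS].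
have [f [hf [ef1 ef2] fd]] := gallery_far_front he far1 ed.
have [ce1 ce2] := ce.
have [||] := @differ_at_agree i c f _ => [j ji|cf|cf].
- by rewrite ce2 // ef2.
- by subst f; exists (p1 ++ p2) => //; exact: reduced_cons redi.
- by exists (i :: p1 ++ p2) => //; exists f.
Qed.

(* Tits: two reduced words for the same element are related by commutations, along
   which galleries can be transported. *)
Lemma gallery_transport A r r' c d : chamber_in A c -> reduced s r -> reduced s r' ->
  'w r = 'w r' -> gallery_in A r c d -> gallery_in A r' c d.
Proof.
elim: r' r c => [|i r' IHr] r c hc red red' e.
  have := red [::] (esym e); rewrite leqn0 => /nilP ->; exact.
have desc_i : ldescent ('w r) i.
  by rewrite e wcons /ldescent cross_smul -/(ldescent ('w r') i) (reduced_cons_ldescent red').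
have [p [q [rE ip]]] := reduced_descent red desc_i; subst r.
move=> /(gallery_far_front hc ip) [f [hf cf fd]].
have redi : reduced s (i :: p ++ q).
  by apply: reduced_eq red; [exact: word_far_front|rewrite /= !size_cat addnS].
exists f; split=> //; apply: IHr fd => //.
- exact: reduced_cons redi.
- exact: reduced_cons red'.
- by apply: (mulgI (s i)); rewrite -!wcons -e word_far_front.
Qed.

End WeakDistance.

(** * Maximal flags as chambers *)

Section Flags.
Variables (n : nat) (G : lgraph n).
Implicit Types (A : set G) (c d e : n.+1.-tuple G) (i j k : 'I_n.+1).
Local Open Scope classical_set_scope.

Lemma chamber_below A c i j : chamber_in A c -> i <= j -> below A (tnth c i) (tnth c j).
Proof.
move=> hc; have [inA _ _] := hc.
move: {2}(j - i) (erefl (j - i)) => m; elim: m i => [|m IHm] i dE le_ij.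
  have -> : i = j by apply: val_inj; rewrite /=; lia.
  exact: below_refl.
have lt_i : i.+1 < n.+1 by have := ltn_ord j; lia.
apply: (below_step _ (chamber_up (j := Ordinal lt_i) hc erefl)) => //.
by apply: IHm => /=; lia.
Qed.

Lemma chamber_incident A c x y : chamber_in A c -> x \in c -> y \in c -> incident A x y.
Proof.
move=> hc /tnthP[i ->] /tnthP[j ->]; apply/incidentE.
by have [le_ij|/ltnW le_ji] := leqP i j; [left|right]; apply: chamber_below.
Qed.

Lemma chamber_types A c : chamber_in A c -> [seq (vtype x : nat) | x <- c] = iota 0 n.+1.
Proof.
move=> [_ ty _]; rewrite -[tval c]map_tnth_enum -map_comp -val_enum_ord.
by apply: eq_map => i /=; rewrite ty.
Qed.

Lemma maximal_flag_chamber A c : maximal_flag A c <-> chamber_in A c.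
Proof.
split=> [[[un cA inc] cT]|hc].
  have ty i : vtype (tnth c i) = i.
    apply: val_inj; have /(congr1 (nth 0 ^~ i)) := cT.
    rewrite nth_iota // add0n (nth_map (tnth c i)) ?size_tuple //.
    by rewrite -tnth_nth.
  split=> [i|//|i j ij]; first by apply: cA; exact: mem_tnth.
  have /incidentE[/below_up h|/below_tp] := inc _ _ (mem_tnth i c) (mem_tnth j c).
    by apply: up_edge; apply: h; rewrite !ty.
  by rewrite !ty -ij ltnn.
have cT := chamber_types hc; split=> //; split.
- by apply: (@map_uniq _ _ (fun x => vtype x : nat)); rewrite cT iota_uniq.
- by move=> v /tnthP[i ->]; case: hc.
- by move=> x y; exact: chamber_incident.
Qed.

Lemma chamber_middle_flag A c : 0 < n -> chamber_in A c ->
  exists r, flag_of_type A (iota 1 n.-1) r.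
Proof.
move=> n0 hc; exists (take n.-1 (behead c)).
have sub v : v \in take n.-1 (behead c) -> v \in c by move/mem_take/mem_behead.
have rT : [seq (vtype x : nat) | x <- take n.-1 (behead c)] = iota 1 n.-1.
  by rewrite map_take -behead_map (chamber_types hc) /= take_iota; congr iota; lia.
split=> //; split.
- by apply: (@map_uniq _ _ (fun x => vtype x : nat)); rewrite rT iota_uniq.
- by move=> v /sub/tnthP[i ->]; case: hc.
- by move=> x y /sub xc /sub yc; exact: chamber_incident hc xc yc.
Qed.

End Flags.

(** * One more clone in a given panel *)

Section FreshClone.
Variables (n : nat) (G : lgraph n) (A : set G) (c : n.+1.-tuple G) (i : 'I_n.+1).
Hypothesis hc : chamber_in A c.
Local Open Scope classical_set_scope.

Definition panel_nbr : pred G := fun u =>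
  [exists k : 'I_n.+1, (u == tnth c k) && ((k.+1 == i) || (i.+1 == k))].

Lemma panel_nbr_edge u : A u -> panel_nbr u -> edge (tnth c i) u.
Proof.
have [_ _ ed] := hc; move=> _ /existsP[k /andP[/eqP-> /orP[]/eqP h]]; last exact: ed.
by rewrite edgeC; exact: ed.
Qed.

Local Notation H := (point_graph panel_nbr_edge).
Local Notation f := (to_point panel_nbr_edge).

Lemma fresh_clone : clone (f @` A) (f (tnth c i)) (None : H).
Proof.
have [inA ty ed] := hc; split.
- by exists (tnth c i).
- by case=> x Ax; rewrite to_pointE.
- by rewrite to_pointE.
- move=> _ [u Au <-]; rewrite point_edge_new // => /(panel_nbr_edge Au).
  by rewrite !to_pointE.
split=> [_ _ [u Au <-] [v Av <-]|k le_k kE].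
  rewrite !point_edge_new // => /existsP[j /andP[/eqP-> _]] /existsP[k /andP[/eqP-> _]].
  by rewrite !to_pointE /= !ty => jk; congr Some; apply: val_inj; rewrite /= (val_inj jk).
have lt_k : k < n.+1 by [].
exists (f (tnth c (Ordinal lt_k))); split; first by exists (tnth c (Ordinal lt_k)).
  rewrite point_edge_new //; apply/existsP; exists (Ordinal lt_k); rewrite eqxx /=.
  by case: kE => /= ->; rewrite ty eqxx ?orbT.
by rewrite to_pointE /= ty.
Qed.

End FreshClone.

(** * The limit *)

Section Limit.
Variables (n : nat) (M : lgraph n).
Hypotheses (n0 : 0 < n) (hM : hrushovski_limit M).
Local Notation s := (@cox_gen n).
Local Notation "''w' u" := (word_prod s u) (at level 8, u at level 8).
Implicit Types (c d e : n.+1.-tuple M) (i j k : 'I_n.+1) (r : seq 'I_n.+1).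
Implicit Types (x y z : chamber M).
Local Open Scope classical_set_scope.

(* The last clause is the extension property applied to A with one clone added to the
   panel of type i of c; it is all that is needed of the extension property. *)
Lemma limit_stage (vs : seq M) : exists A : set M,
  [/\ built A, forall v, v \in vs -> A v &
      forall c i, chamber_in A c -> exists v, [/\ ~ A v, vtype v = i &
        forall j, i.+1 = j :> nat \/ j.+1 = i :> nat -> edge v (tnth c j)]].
Proof.
have [A_ [[K' [r [flr rE]]] str cup ext]] := hM.
have bA m : built (A_ m).
  elim: m => [|m IHm]; first exact: built_flag (maximal_flag_set flr rE).
  by have [] := strong_built n0 (str m) IHm.
have mono m m' : m <= m' -> A_ m `<=` A_ m'.
  elim: m' => [|m' IHm']; first by rewrite leqn0 => /eqP->.
  rewrite leq_eqVlt => /predU1P[->//|]; rewrite ltnS => /IHm' sub v /sub.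
  by have [_] := strong_built n0 (str m') (bA m'); apply.
have [m vsA] : exists m, forall v, v \in vs -> A_ m v.
  elim: vs => [|v vs [m IHvs]]; first by exists 0.
  have [m' _ Av] : (\bigcup_i A_ i) v by rewrite cup.
  exists (maxn m m') => u; rewrite in_cons => /predU1P[->|/IHvs].
    by apply: mono Av; exact: leq_maxr.
  by apply: mono; exact: leq_maxl.
exists (A_ m); split=> // c i hc; have [inA ty ed] := hc.
pose f := to_point (panel_nbr_edge (i := i) hc).
have cl := fresh_clone i hc.
have emb : embedding_on (A_ m) f := to_point_embedding _.
have bf : built (f @` A_ m) by exact: built_image.
have E := point_setT (panel_nbr_edge (i := i) hc).
have K'H : classK' [set: point_graph (panel_nbr_edge (i := i) hc)].
  by rewrite E; apply: built_classK'; exact: built_clone cl.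
have strH : strong (f @` A_ m) setT.
  by rewrite E; apply: Relation_Operators.rt_step; exact: clone_elementary cl.
have neA : A_ m !=set0 by exists (tnth c i).
have [j [g [_ [gi gt ge] gK _]]] := ext m (A_ m) (K' m) neA (chamber_middle_flag n0 hc)
  (Relation_Operators.rt_refl _ _ _) _ f emb K'H strH.
have inT h : h \in [set: point_graph (panel_nbr_edge (i := i) hc)] by rewrite inE.
exists (g None); split.
(* If [g None] were in [A_ m], then [g] would agree at [None] and at the old vertex [f (g None)],
   against injectivity. *)
- move=> Ag; have := gi _ _ (inT (f (g None))) (inT None).
  by rewrite gK ?inE // => /(_ erefl); rewrite /f to_pointE.
- by rewrite gt //= ty.
move=> k ik; rewrite -(gK (tnth c k)) ?inE // ge //.
rewrite /f point_edge_new //; apply/existsP; exists k; rewrite eqxx /=.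
by case: ik => ->; rewrite eqxx ?orbT.
Qed.

Lemma chamber_stage A c : chamber_in setT c -> (forall v, v \in c -> A v) -> chamber_in A c.
Proof. by move=> [_ ty ed] cA; split=> // i; apply/cA/mem_tnth. Qed.

(** A gallery has finitely many vertices, so questions about it can be settled in a stage of the
    chain. *)
Lemma gallery_vertices r c d : gallery_in setT r c d -> exists vs : seq M,
  forall A, (forall v, v \in vs -> A v) -> gallery_in A r c d.
Proof.
elim: r c => [|i r IHr] c /=; first by exists [::].
move=> [e [he ce /IHr[vs vsP]]]; exists (e ++ vs) => A inA.
exists e; split=> //; last by apply: vsP => v vvs; apply: inA; rewrite mem_cat vvs orbT.
by apply: chamber_stage he _ => v ve; apply: inA; rewrite mem_cat ve.
Qed.

Lemma limit_connected c d : chamber_in setT c -> chamber_in setT d -> exists r, gallery_in [set: M] r c d.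
Proof.
move=> hc hd; have [A [bA inA _]] := limit_stage (c ++ d).
have hcA : chamber_in A c by apply: chamber_stage hc _ => v vc; apply: inA; rewrite mem_cat vc.
have hdA : chamber_in A d by apply: chamber_stage hd _ => v vd; apply: inA; rewrite mem_cat vd orbT.
have [r g] := gallery_connected bA hcA hdA.
by exists r; apply: gallery_mono g.
Qed.

Lemma limit_word_unique r r' c d : chamber_in setT c -> reduced s r -> reduced s r' ->
  gallery_in [set: M] r c d -> gallery_in setT r' c d -> 'w r = 'w r'.
Proof.
move=> hc red red' /gallery_vertices[vs gr] /gallery_vertices[vs' gr'].
have [A [bA inA _]] := limit_stage (c ++ (vs ++ vs')).
apply: (@gallery_word_unique _ _ A r r' c d) => //.
- by apply: chamber_stage hc _ => v vc; apply: inA; rewrite mem_cat vc.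
- by apply: gr => v vv; apply: inA; rewrite !mem_cat vv !orbT.
- by apply: gr' => v vv; apply: inA; rewrite !mem_cat vv !orbT.
Qed.

Lemma chamber_inP x : chamber_in setT (val x).
Proof. by apply/maximal_flag_chamber; exact: set_mem (valP x). Qed.

Lemma chamber_of c : chamber_in [set: M] c -> exists x, val x = c.
Proof. by move=> /maximal_flag_chamber hc; exists (exist _ c (mem_set hc)). Qed.

Lemma differ_exactlyE i x y : differ_exactly i x y <-> differ_at i (val x) (val y).
Proof.
rewrite /differ_exactly /chamber_vertex; split=> [df|[ne eq] j].
  split=> [|j /eqP ji]; first exact/df.
  by have [//|/eqP/df/ji] := eqVneq (tnth (val x) j) (tnth (val y) j).
split=> [nej|->//]; have [//|/eq] := eqVneq j i.
by [].
Qed.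

(** Uses galleries defined by differing vertices, which avoids the circularity of [gallery], where
    the distance itself occurs. *)
Definition at_distance x y (w : cox n) :=
  exists r, [/\ reduced s r, 'w r = w & gallery_in setT r (val x) (val y)].

Lemma at_distance_ex x y : exists w, at_distance x y w.
Proof.
have [r g] := limit_connected (chamber_inP x) (chamber_inP y).
have [r' red g'] := gallery_reduced (chamber_inP x) g.
by exists ('w r'), r'.
Qed.

Lemma at_distance_unique x y w w' : at_distance x y w -> at_distance x y w' -> w = w'.
Proof.
move=> [r [red <- g]] [r' [red' <- g']].
exact: limit_word_unique (chamber_inP x) red red' g g'.
Qed.

Lemma at_distance_word x y r : reduced s r ->
  at_distance x y ('w r) <-> gallery_in setT r (val x) (val y).
Proof.
move=> red; split=> [[r' [red' e g]]|g]; last by exists r.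
exact: gallery_transport (chamber_inP x) red' red e g.
Qed.

Lemma reduced_nil : reduced s [::]. Proof. by move=> r. Qed.

Lemma reduced_seq1 i : reduced s [:: i].
Proof. by apply: not_ldescent_reduced reduced_nil _; rewrite wnil /ldescent cross1. Qed.

Lemma gallery_inE (delta : chamber M -> chamber M -> cox n) r x y :
  (forall i x y, delta x y = cox_gen i <-> differ_exactly i x y) ->
  gallery s delta r x y <-> gallery_in setT r (val x) (val y).
Proof.
move=> dE; elim: r x => [|i r IHr] x /=.
  by split=> [->//|/val_inj].
split=> [[z [_ /dE/differ_exactlyE xz /IHr zy]]|[e [he xe ey]]].
  by exists (val z); split=> //; exact: chamber_inP.
have [z zE] := chamber_of he; exists z; rewrite -zE in xe ey; split; last exact/IHr.
- by move=> e1; case: xe => + _; apply; rewrite e1.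
- exact/dE/differ_exactlyE.
Qed.

Lemma flag_distance_of (delta : chamber M -> chamber M -> cox n) :
  (forall x y, at_distance x y (delta x y)) -> flag_distance delta.
Proof.
move=> dP; have dE x y w : delta x y = w <-> at_distance x y w.
  by split=> [<-//|]; exact: at_distance_unique.
have d1 i x y : delta x y = cox_gen i <-> differ_exactly i x y.
  rewrite dE -wseq1 (at_distance_word x y (reduced_seq1 (i := i))) differ_exactlyE /=.
  split=> [[e [_ xe <-]]//|xy]; exists (val y); split=> //; exact: chamber_inP.
split=> //.
- by move=> x; apply/dE; rewrite -wnil; apply/(at_distance_word x x reduced_nil).
- by move=> r red x y; rewrite (gallery_inE _ _ _ d1) dE; exact: at_distance_word.
Qed.

(** The values at generators fix adjacency, so the galleries of [delta] are the intrinsic ones; any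
    two chambers are joined by a reduced one, which determines [delta]. *)
Lemma flag_distanceP (delta : chamber M -> chamber M -> cox n) :
  flag_distance delta -> forall x y, at_distance x y (delta x y).
Proof.
move=> [_ d1 d2] x y; have [w [r [red _ g]]] := at_distance_ex x y.
by exists r; split=> //; apply/esym/d2/(gallery_inE _ _ _ d1).
Qed.

(** * Panels of the limit *)

Section Panels.
Variable delta : chamber M -> chamber M -> cox n.
Hypothesis dl : flag_distance delta.

Lemma adjacentE i x y : adjacent s delta i x y <->
  forall j, j != i -> tnth (val x) j = tnth (val y) j.
Proof.
have [d0 d1 d2] := dl; rewrite /adjacent; split.
  case=> [|/d1/differ_exactlyE[]//]; rewrite -wnil => /(d2 _ reduced_nil) /= -> //.
by move=> /differ_at_agree[/val_inj->|/differ_exactlyE/d1]; [left|right].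
Qed.

(** If the panel were finite, a stage would contain [x] and all vertices of type [i] in the panel;
    the fresh vertex over that stage gives one more chamber of the panel. *)
Lemma panel_infinite i x : infinite_set [set y | adjacent s delta i x y].
Proof.
move=> /(finite_image (fun y => tnth (val y) i)) /finite_seqP[vs vsE].
have [A [_ inA fresh]] := limit_stage (val x ++ vs).
have hx : chamber_in A (val x).
  by apply: chamber_stage (chamber_inP x) _ => v vx; apply: inA; rewrite mem_cat vx.
have [v [nAv vi ve]] := fresh _ i hx.
have [|y yE] := @chamber_of (set_vertex (val x) i v).
  by apply: set_vertex_chamber => //; exact: chamber_inP.
apply/nAv/inA; rewrite mem_cat; apply/orP; right.
have : [set` vs] v; last by [].
rewrite -vsE; exists y; last by rewrite yE set_vertex_same.
by apply/adjacentE => j ji; rewrite yE set_vertex_other.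
Qed.

Lemma limit_countable : countable [set: M].
Proof.
have [A_ [[K' _] _ <- _]] := hM.
by apply: bigcup_countable => // i _; apply: finite_set_countable; case: (K' i) => -[].
Qed.

(** A chamber of the panel is determined by its vertex of type [i], and the limit is a countable
    union of finite sets. *)
Lemma panel_card i x : ([set y | adjacent s delta i x y] #= [set: nat])%card.
Proof.
apply: eq_card_nat; last exact: panel_infinite.
have /countable_injP[f finj] := limit_countable.
apply/countable_injP; exists (fun y => f (tnth (val y) i)) => y z.
rewrite !inE => /adjacentE xy /adjacentE xz /finj; rewrite !inE => /(_ I I) e.
apply: val_inj; apply: eq_from_tnth => j; have [->//|ji] := eqVneq j i.
by rewrite -xy // xz.
Qed.

(** The gallery axiom is the last clause of [flag_distance]; panels have two elements because they
    are infinite. *)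
Lemma limit_building : building s delta.
Proof.
have [d0 d1 d2] := dl; split=> [i|//]; split.
  split.
  - by move=> x; left; exact: d0.
  - move=> x y z /adjacentE xy /adjacentE yz; apply/adjacentE => j ji.
    by rewrite xy // yz.
  - by move=> x y /adjacentE xy; apply/adjacentE => j ji; rewrite xy.
move=> x; apply: contrapT => no; apply: (@panel_infinite i x).
apply: (@sub_finite_set _ _ [set x]); last exact: finite_set1.
move=> y xy /=; apply: contrapT => ne; apply: no; exists y, x; split=> //.
by left; exact: d0.
Qed.

End Panels.
End Limit.

Local Open Scope classical_set_scope.

Theorem theorem4p1 (n : nat) (hn : (1 <= n)%N) (M : lgraph n)
    (hM : hrushovski_limit M) :
  (exists! delta : chamber M -> chamber M -> cox n, flag_distance delta) /\
  (forall delta : chamber M -> chamber M -> cox n, flag_distance delta ->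
     building (@cox_gen n) delta /\
     forall (i : 'I_n.+1) (x : chamber M),
       ([set y | adjacent (@cox_gen n) delta i x y] #= [set: nat])%card).
Proof.
split; last first.
  move=> delta dl; split; first exact: limit_building.
  by move=> i x; exact: panel_card.
(* The distance is chosen pointwise as the type of a reduced gallery, on pairs because [choice]
   takes a single argument. *)
have /choice[f fP] (xy : chamber M * chamber M) : exists w, at_distance xy.1 xy.2 w.
  exact: at_distance_ex.
exists (fun x y => f (x, y)); split.
  by apply: flag_distance_of => // x y; exact: (fP (x, y)).
move=> delta /(flag_distanceP hn hM) dP; apply/funext => x; apply/funext => y.
exact: at_distance_unique (fP (x, y)) (dP x y).
Qed.
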